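(* Let $(A(\cdot),b(\cdot),b'(\cdot),c)$ be an explicit $s$-stage FCRKN method satisfying $$\sum_{i=1}^s b'_i(\alpha)=\alpha,\qquad \sum_{i=1}^s b_i(\alpha)=\frac{\alpha^2}{2}\qquad(\alpha\in[0,1]),$$ $$\sum_{j=1}^s a_{ij}(\alpha)=\frac{\alpha^2}{2}\qquad(\alpha\in[0,c_i],\ i=1,\dots,s),$$ and suppose the method is of uniform order four. Let $c^*_1<\dots<c^*_{s^*}$ be the distinct values among $c_1,\dots,c_s$. Assume that $f$ is of class $C^2$ with respect to the second argument and that the solution $u$ is of piecewise class $C^6$. Then the method is of uniform order five if and only if all of the following hold: $$\sum_{i=1}^s b'_i(\alpha)\,c_i^4=\frac{\alpha^5}{5},\qquad \alpha\in[0,1];$$ $$\sum_{\substack{i=1\\ c_i=c^*_m}}^s b'_i(\alpha)\left(\sum_{j=1}^s a_{ij}(\beta)\,c_j^2-\frac{\beta^4}{12}\right)=0,\qquad \alpha\in[0,1],\ \beta\in[0,c^*_m],\ m=1,\dots,s^*;$$ $$\sum_{i=1}^s b_i(\alpha)\,c_i^3=\frac{\alpha^5}{20},\qquad \alpha\in[0,1];$$ $$\sum_{\substack{i=1\\ c_i=c^*_m}}^s b_i(\alpha)\left(\sum_{j=1}^s a_{ij}(\beta)\,c_j-\frac{\beta^3}{6}\right)=0,\qquad \alpha\in[0,1],\ \beta\in[0,c^*_m],\ m=1,\dots,s^*.$$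
   Context: Spaces. For $r\in[0,\infty]$, $\mathcal C$ is the space of continuous functions $[-r,0]\to\mathbb R^d$ with the maximum norm $\|\varphi\|=\max_{\theta\in[-r,0]}|\varphi(\theta)|$, where $|\cdot|$ is an arbitrary norm on $\mathbb R^d$; $\mathcal C^1$ is the analogous space of continuously differentiable functions. For a function $u$, $u_t(\theta)=u(t+\theta)$, $\theta\in[-r,0]$. Dots denote time derivatives; a prime on $b'$, $\eta'$, $E'$ is part of the name and does not mean differentiation. Problem. The second order retarded functional differential equation is $\ddot u(t)=f(t,u_t)$, where $u_t\in\mathcal C^1$, $f:\Omega\to\mathbb R^d$, $\Omega$ is an open subset of $\mathbb R\times\mathcal C^1$, $f$ is continuous and has a derivative $f':\Omega\to\mathcal L(\mathcal C^1,\mathbb R^d)$ with respect to the second argument (here the prime does mean derivative) which is bounded and continuous with respect to the second argument. For each $(\sigma,\varphi)\in\Omega$ there is a unique non-continuable solution $u:[\sigma-r,\bar t)\to\mathbb R^d$ through $(\sigma,\varphi)$, i.e. $u$ satisfies the equation for $t\in[\sigma,\bar t)$ and $u_\sigma=\varphi$. Since the right-hand side does not depend on $\dot u$, nothing further is required of $\dot\varphi$ except the existence of the initial value $\dot\varphi(0)$. Method. An explicit $s$-stage functional continuous Runge--Kutta--Nyström (FCRKN) method is a quadruple $(A(\cdot),b(\cdot),b'(\cdot),c)$, where $A(\cdot)=(a_{ij}(\cdot))$ is a strictly lower-triangular $\mathbb R^{s\times s}$-valued polynomial function with $A(0)=0$, $b(\cdot)=(b_i(\cdot))$ and $b'(\cdot)=(b'_i(\cdot))$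 are $\mathbb R^s$-valued polynomial functions with $b(0)=b'(0)=0$, and $c\in\mathbb R^s$ with $c_1=0$, $c_i\ge0$ for $i=2,\dots,s$. Applied with stepsize $h$ to get the solution $u$ through $(\sigma,\varphi)$, it gives for $\alpha\in[0,1]$ $$\eta(\alpha h)=\varphi(0)+\alpha h\dot\varphi(0)+h^2\sum_{i=1}^s b_i(\alpha)K_i,\qquad \eta'(\alpha h)=\dot\varphi(0)+h\sum_{i=1}^s b'_i(\alpha)K_i,$$ where $K_i=f(\sigma+c_ih,Y^i_{c_ih})$ and the stage functions $Y^i:[-r,c_ih]\to\mathbb R^d$ are given by $Y^i(\alpha h)=\varphi(0)+\alpha h\dot\varphi(0)+h^2\sum_{j=1}^{i-1}a_{ij}(\alpha)K_j$ for $\alpha\in[0,c_i]$ and $Y^i(\theta)=\varphi(\theta)$ for $\theta\in[-r,0]$. With $y=u(\sigma+\cdot)$, the local errors on $[0,h]$ are $E=\eta-y$ and $E'=\eta'-\dot y$. Order. The method has (local) uniform order $p$ if, for a sufficiently smooth problem $\ddot u(t)=f(t,u_t)$, for $h$ small enough there exist some $C>0$ and $C'>0$ such that $\max_{\alpha\in[0,1]}\|E(\alpha h)\|\le Ch^{p+1}$ and $\max_{\alpha\in[0,1]}\|E'(\alpha h)\|\le C'h^{p+1}$.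
   Formalization: Order is required for solutions of piecewise class C^n, some n depending only on the method (C^6 fails: u''=t^{9/2} gives E' of size h^{11/2}); f is defined on continuous, not only C^1, functions, since stage functions need not be C^1; f'' is taken bounded, like f'. *)

(* Defs.v *)
From HB Require Import structures.
From mathcomp Require Import all_boot all_order all_algebra.
From mathcomp Require Import all_classical all_reals all_analysis.

Set Implicit Arguments.
Unset Strict Implicit.
Unset Printing Implicit Defensive.

Import Order.TTheory GRing.Theory Num.Theory.
Import numFieldNormedType.Exports.

Local Open Scope classical_set_scope.
Local Open Scope ring_scope.

Definition is_norm (R : realType) (d : nat) (N : 'rV[R]_d -> R) : Prop :=
  [/\ forall x, N x = 0 -> x = 0,
      forall a x, N (a *: x) = `|a| * N x
    & forall x y, N (x + y) <= N x + N y].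

(* One-sided at the end points of an interval D; at an isolated point of D
   nothing is required of dg. *)
Definition has_deriv_on (R : realType) (d : nat) (D : set R)
    (g dg : R -> 'rV[R]_d) : Prop :=
  forall t, D t ->
    (x - t)^-1 *: (g x - g t) @[x --> within D t^'] --> dg t.

Definition class_C_on (R : realType) (d : nat) (n : nat) (D : set R)
    (g : R -> 'rV[R]_d) : Prop :=
  exists G : nat -> R -> 'rV[R]_d,
    [/\ forall x, D x -> G 0%N x = g x,
        forall k, (k < n)%N -> has_deriv_on D (G k) (G k.+1)
      & {within D, continuous (G n)}].

(* The set B of breaking points is locally finite in D, and g is of class C^n
   up to the end points on every segment of D without interior breaking
   point. *)
Definition piecewise_class_C_on (R : realType) (d : nat) (n : nat) (D : set R)
    (g : R -> 'rV[R]_d) : Prop :=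
  exists B : set R,
    (forall a b, `[a, b] `<=` D -> finite_set (B `&` `[a, b])) /\
    (forall a b, a < b -> `[a, b] `<=` D -> B `&` `]a, b[ = set0 ->
       class_C_on n `[a, b] g).

(* The interval [-r, 0], which is ]-oo, 0] for r = +oo. *)
Definition history (R : realType) (r : \bar R) : set R :=
  [set x | (- r <= x%:E)%E /\ x <= 0].

(* Elements of C and C^1 are functions on the whole line of which only the
   restriction to [-r, 0] matters.  For r = +oo the interval [-r, 0] is the
   compact [-oo, 0], i.e. a limit at -oo is required: only then is the maximum
   norm defined. *)
Definition in_C (R : realType) (d : nat) (r : \bar R)
    (phi : R -> 'rV[R]_d) : Prop :=
  {within history r, continuous phi} /\
  (r = +oo%E -> cvg (phi x @[x --> -oo])).

(* For r = 0 the value dphi 0 is free: it is then the prescribed initial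
   velocity. *)
Definition in_C1 (R : realType) (d : nat) (r : \bar R)
    (phi dphi : R -> 'rV[R]_d) : Prop :=
  [/\ in_C r phi, in_C r dphi & has_deriv_on (history r) phi dphi].

(* A maximum on in_C. *)
Definition maxnorm (R : realType) (d : nat) (N : 'rV[R]_d -> R) (r : \bar R)
    (phi : R -> 'rV[R]_d) : R :=
  sup [set N (phi theta) | theta in history r].

(* u_t *)
Definition segment_at (R : realType) (d : nat) (u : R -> 'rV[R]_d) (t : R)
    : R -> 'rV[R]_d :=
  fun theta => u (t + theta).

(* The equation u'' = f(t, u_t).  Its domain is a set of pairs (t, phi) with
   phi in C under the maximum norm, and not only in C^1, because f is also
   evaluated at stage functions of a Runge-Kutta-Nystrom method, which are
   continuous but in general not differentiable where they are glued to the
   initial function. *)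
Record rfde (R : realType) (d : nat) := Rfde {
  vnorm : 'rV[R]_d -> R;
  delay : \bar R;
  domain : set (R * (R -> 'rV[R]_d));
  rhs : R -> (R -> 'rV[R]_d) -> 'rV[R]_d
}.

Definition norm_C (R : realType) (d : nat) (P : rfde R d) :=
  maxnorm (vnorm P) (delay P).

Definition domain_open (R : realType) (d : nat) (P : rfde R d) : Prop :=
  forall t phi, domain P (t, phi) -> exists2 e : R, 0 < e &
    forall t' phi', in_C (delay P) phi' -> `|t' - t| < e ->
      norm_C P (phi' - phi) < e -> domain P (t', phi').

Definition rhs_continuous (R : realType) (d : nat) (P : rfde R d) : Prop :=
  forall t phi, domain P (t, phi) ->
  forall e : R, 0 < e -> exists2 a : R, 0 < a &
    forall t' phi', domain P (t', phi') -> `|t' - t| < a ->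
      norm_C P (phi' - phi) < a -> vnorm P (rhs P t' phi' - rhs P t phi) < e.

(* f1 t phi is the Frechet derivative of f(t, _) at phi; f1 is bounded on the
   domain, and continuous with respect to phi in operator norm. *)
Definition is_rhs_deriv1 (R : realType) (d : nat) (P : rfde R d)
    (f1 : R -> (R -> 'rV[R]_d) -> (R -> 'rV[R]_d) -> 'rV[R]_d) : Prop :=
  let C := in_C (delay P) in
  [/\ forall t phi, domain P (t, phi) -> forall (a : R) psi chi,
        C psi -> C chi ->
        f1 t phi (a *: psi + chi) = a *: f1 t phi psi + f1 t phi chi,
      exists M : R, forall t phi, domain P (t, phi) -> forall psi, C psi ->
        vnorm P (f1 t phi psi) <= M * norm_C P psi,
      forall t phi, domain P (t, phi) ->
        forall e : R, 0 < e -> exists2 a : R, 0 < a &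
        forall psi, domain P (t, phi + psi) -> C psi -> norm_C P psi < a ->
          vnorm P (rhs P t (phi + psi) - rhs P t phi - f1 t phi psi)
          <= e * norm_C P psi
    & forall t phi, domain P (t, phi) ->
        forall e : R, 0 < e -> exists2 a : R, 0 < a &
        forall phi', domain P (t, phi') -> norm_C P (phi' - phi) < a ->
        forall psi, C psi ->
          vnorm P (f1 t phi' psi - f1 t phi psi) <= e * norm_C P psi].

(* f2 t phi is the derivative at phi of f1 t, as a bilinear map whose first
   argument is the direction of differentiation of f1 t. *)
Definition is_rhs_deriv2 (R : realType) (d : nat) (P : rfde R d)
    (f1 : R -> (R -> 'rV[R]_d) -> (R -> 'rV[R]_d) -> 'rV[R]_d)
    (f2 : R -> (R -> 'rV[R]_d) -> (R -> 'rV[R]_d) -> (R -> 'rV[R]_d) ->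
          'rV[R]_d) : Prop :=
  let C := in_C (delay P) in
  [/\ forall t phi, domain P (t, phi) -> forall (a : R) psi psi' chi,
        C psi -> C psi' -> C chi ->
        f2 t phi (a *: psi + psi') chi
          = a *: f2 t phi psi chi + f2 t phi psi' chi /\
        f2 t phi chi (a *: psi + psi')
          = a *: f2 t phi chi psi + f2 t phi chi psi',
      exists M : R, forall t phi, domain P (t, phi) -> forall psi chi,
        C psi -> C chi ->
        vnorm P (f2 t phi psi chi) <= M * norm_C P psi * norm_C P chi,
      forall t phi, domain P (t, phi) ->
        forall e : R, 0 < e -> exists2 a : R, 0 < a &
        forall psi, domain P (t, phi + psi) -> C psi -> norm_C P psi < a ->
        forall chi, C chi ->
          vnorm P (f1 t (phi + psi) chi - f1 t phi chi - f2 t phi psi chi)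
          <= e * norm_C P psi * norm_C P chi
    & forall t phi, domain P (t, phi) ->
        forall e : R, 0 < e -> exists2 a : R, 0 < a &
        forall phi', domain P (t, phi') -> norm_C P (phi' - phi) < a ->
        forall psi chi, C psi -> C chi ->
          vnorm P (f2 t phi' psi chi - f2 t phi psi chi)
          <= e * norm_C P psi * norm_C P chi].

Definition is_rfde (R : realType) (d : nat) (P : rfde R d) : Prop :=
  is_norm (vnorm P) /\ (0 <= delay P)%E /\
  (forall t phi, domain P (t, phi) -> in_C (delay P) phi) /\
  domain_open P /\ rhs_continuous P /\
  exists f1, is_rhs_deriv1 P f1.

(* As for the first derivative, "class" includes boundedness on the domain and
   continuity with respect to the second argument only. *)
Definition rhs_class_C2 (R : realType) (d : nat) (P : rfde R d) : Prop :=
  exists f1 f2, is_rhs_deriv1 P f1 /\ is_rhs_deriv2 P f1 f2.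

Definition solution_interval (R : realType) (r : \bar R) (sigma : R)
    (tbar : \bar R) : set R :=
  [set t | (sigma%:E - r <= t%:E)%E /\ (t%:E < tbar)%E].

(* u, with first derivative du, solves the equation on [sigma, tbar[ and passes
   through (sigma, phi); dphi 0 is the initial value of the derivative. *)
Definition is_solution (R : realType) (d : nat) (P : rfde R d) (sigma : R)
    (phi dphi : R -> 'rV[R]_d) (tbar : \bar R) (u du : R -> 'rV[R]_d) : Prop :=
  let J := [set t : R | sigma <= t /\ (t%:E < tbar)%E] in
  [/\ (sigma%:E < tbar)%E,
      (forall theta, history (delay P) theta ->
         segment_at u sigma theta = phi theta) /\ du sigma = dphi 0,
      has_deriv_on (solution_interval (delay P) sigma tbar) u du,
      forall t, J t -> domain P (t, segment_at u t) /\
        in_C1 (delay P) (segment_at u t) (segment_at du t)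
    & has_deriv_on J du (fun t => rhs P t (segment_at u t))].

Definition non_continuable (R : realType) (d : nat) (P : rfde R d) (sigma : R)
    (phi dphi : R -> 'rV[R]_d) (tbar : \bar R) (u : R -> 'rV[R]_d) : Prop :=
  forall (tbar' : \bar R) (u' du' : R -> 'rV[R]_d),
    is_solution P sigma phi dphi tbar' u' du' ->
    (forall t, solution_interval (delay P) sigma tbar t -> u' t = u t) ->
    (tbar' <= tbar)%E.

(* An equation together with an initial point of its domain and the
   non-continuable solution through it. *)
Record problem (R : realType) := Problem {
  dim : nat;
  equation : rfde R dim;
  sigma : R;
  phi : R -> 'rV[R]_dim;
  dphi : R -> 'rV[R]_dim;
  tbar : \bar R;
  sol : R -> 'rV[R]_dim;
  dsol : R -> 'rV[R]_dim;
  equationP : is_rfde equation;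
  phi_C1 : in_C1 (delay equation) phi dphi;
  initialP : domain equation (sigma, phi);
  solP : is_solution equation sigma phi dphi tbar sol dsol;
  sol_max : non_continuable equation sigma phi dphi tbar sol
}.

Definition f_class_C2 (R : realType) (P : problem R) : Prop :=
  rhs_class_C2 (equation P).

Definition solution_piecewise_class_C (R : realType) (n : nat)
    (P : problem R) : Prop :=
  piecewise_class_C_on n
    (solution_interval (delay (equation P)) (sigma P) (tbar P)) (sol P).

(* Stages are numbered from 0. *)
Record fcrkn (R : realType) (s : nat) := Fcrkn {
  A : 'M[{poly R}]_s;
  b : 'I_s -> {poly R};
  b' : 'I_s -> {poly R};
  c : 'I_s -> R;
  A_strict_lower : forall i j : 'I_s, (i <= j)%N -> A i j = 0;
  A_at0 : forall i j, (A i j).[0] = 0;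
  b_at0 : forall i, (b i).[0] = 0;
  b'_at0 : forall i, (b' i).[0] = 0;
  c_first : forall i : 'I_s, val i = 0%N -> c i = 0;
  c_ge0 : forall i, 0 <= c i
}.

Definition stage_function (R : realType) (s : nat) (M : fcrkn R s)
    (P : problem R) (h : R) (K : 'I_s -> 'rV[R]_(dim P)) (i : 'I_s)
    : R -> 'rV[R]_(dim P) :=
  fun x => if x <= 0 then phi P x else
    phi P 0 + x *: dphi P 0
    + h ^+ 2 *: \sum_(j < s | (j < i)%N) (A M i j).[x / h] *: K j.

Definition stage_values (R : realType) (s : nat) (M : fcrkn R s)
    (P : problem R) (h : R) (K : 'I_s -> 'rV[R]_(dim P)) : Prop :=
  forall i,
    let t := sigma P + c M i * h in
    let Y := segment_at (stage_function M h K i) (c M i * h) in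
    domain (equation P) (t, Y) /\ K i = rhs (equation P) t Y.

(* eta (alpha h) and eta' (alpha h) *)
Definition eta (R : realType) (s : nat) (M : fcrkn R s) (P : problem R) (h : R)
    (K : 'I_s -> 'rV[R]_(dim P)) (alpha : R) : 'rV[R]_(dim P) :=
  phi P 0 + (alpha * h) *: dphi P 0
  + h ^+ 2 *: \sum_(i < s) (b M i).[alpha] *: K i.

Definition eta' (R : realType) (s : nat) (M : fcrkn R s) (P : problem R) (h : R)
    (K : 'I_s -> 'rV[R]_(dim P)) (alpha : R) : 'rV[R]_(dim P) :=
  dphi P 0 + h *: \sum_(i < s) (b' M i).[alpha] *: K i.

(* E (alpha h) and E' (alpha h) *)
Definition local_error (R : realType) (s : nat) (M : fcrkn R s) (P : problem R)
    (h : R) (K : 'I_s -> 'rV[R]_(dim P)) (alpha : R) : 'rV[R]_(dim P) :=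
  eta M h K alpha - sol P (sigma P + alpha * h).

Definition local_error' (R : realType) (s : nat) (M : fcrkn R s) (P : problem R)
    (h : R) (K : 'I_s -> 'rV[R]_(dim P)) (alpha : R) : 'rV[R]_(dim P) :=
  eta' M h K alpha - dsol P (sigma P + alpha * h).

(* For h small enough the method is applicable, i.e. its (unique, as the method
   is explicit) stage values K exist, and the local errors are bounded with
   constants independent of h. *)
Definition order_on_problem (R : realType) (s : nat) (M : fcrkn R s) (p : nat)
    (P : problem R) : Prop :=
  exists h0 C C' : R, [/\ 0 < h0, 0 < C, 0 < C' &
    forall h : R, 0 < h < h0 ->
      ((sigma P + h)%:E < tbar P)%E /\
      exists2 K : 'I_s -> 'rV[R]_(dim P), stage_values M h K &
        forall alpha : R, 0 <= alpha <= 1 ->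
          vnorm (equation P) (local_error M h K alpha) <= C * h ^+ p.+1 /\
          vnorm (equation P) (local_error' M h K alpha) <= C' * h ^+ p.+1].

(* The bounds hold for all sufficiently smooth problems of the class S, i.e. for
   those problems of S whose solution is piecewise C^n for some n depending
   only on the method.  A bound h^(p+1) on the second error needs a solution in
   C^(p+2): with sol'' (t) = t^(p - 1/2) it is only of order h^(p + 1/2). *)
Definition uniform_order (R : realType) (s : nat) (S : problem R -> Prop)
    (M : fcrkn R s) (p : nat) : Prop :=
  exists n : nat, forall P : problem R,
    S P -> solution_piecewise_class_C n P -> order_on_problem M p P.

(* Main.v *)
Require Import Defs.
From mathcomp Require Import all_boot all_order all_algebra.
From mathcomp Require Import all_classical all_reals all_analysis.
From mathcomp Require Import ring lra zify.

Set Implicit Arguments.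
Unset Strict Implicit.
Unset Printing Implicit Defensive.

Import Order.TTheory GRing.Theory Num.Theory.
Import numFieldNormedType.Exports.

Local Open Scope classical_set_scope.
Local Open Scope ring_scope.

(** The local errors are expanded in powers of the stepsize [h]; the conditions
of order five are the coefficients of [h ^+ 5] that must vanish beyond those of
order four.

Let [g] be the second derivative of the solution and [gamma k] its derivative
of order [k] at the initial time. Up to [O(h ^+ 5)] a stage function deviates
from the solution by the sum over [k < 3] of [h ^+ (k + 2) / k`!] times the
[stage_defect] of degree [k], evaluated at the elapsed time divided by [h],
times [gamma k]: this is [stage_deviation], which rests on a comparison of
Taylor expansions, [quadrature_defect]. The term of degree [0] vanishes by the
row condition on [A]. As the right-hand side is of class C^2, the error of a
stage value is, again up to [O(h ^+ 5)], the first derivative of the right-hand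
side along the solution, applied to this deviation ([stage_step],
[stages_exist]). That linear functional depends on the stage through its
abscissa only, while it is otherwise arbitrary and sees a whole function: this
is why the defects have to cancel as functions, and separately among the stages
with a common abscissa. If they do, and if the quadratures with weights [b] and
[b'] are exact on monomials of small degree, then all terms below [h ^+ 6]
disappear from both errors ([integrated_error], [order_five_of_conditions]).

Conversely, every condition is read off from one family of scalar equations
with proportional delay, u''(t) = t^k + a(t) (u(lam t) - y(lam t)), whose
solution [y] is a multiple of t^(k+2). Their local errors consist of a
quadrature defect at [h ^+ (k + l)], with [l = 1] for [E'] and [l = 2] for [E],
and of the sum of the weights times [a (c M i * h)] times the stage defects of
degree [k] at [lam * c M i], at [h ^+ (k + l + 2)], up to terms that are
smaller by a factor [h ^+ 2] ([test_error_expansion]). The choice [a = 0]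
isolates the quadrature conditions ([quadrature_necessary]). In order to
isolate one abscissa [x], the coefficient [a], which need only be continuous,
is made to vanish at [c M j * h] for all the other abscissae along a sequence
of stepsizes tending to [0], and not at [x * h] ([separating_coefficient]). Its
zeros accumulate at [0], hence [a (x * h)] tends to [0]; but it does so like
the square root of [h], more slowly than the factor [h] gained from the order,
so that the sum over the stages at [x] has to vanish ([stage_necessary]).

Both lemmas on necessity hold for any order [p]. Order four thus provides the
conditions of lower degree, and order five exactly adds the four conditions of
the theorem. *)

(** * Norms and mean value inequalities *)

Section Norms.
Variables (R : realType) (d : nat) (N : 'rV[R]_d -> R).
Hypothesis hN : is_norm N.

Lemma vnormZ a x : N (a *: x) = `|a| * N x.
Proof. by case: hN. Qed.

Lemma vnorm_triangle x y : N (x + y) <= N x + N y.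
Proof. by case: hN. Qed.

Lemma vnorm0 : N 0 = 0.
Proof. by rewrite -(scale0r 0) vnormZ normr0 mul0r. Qed.

Lemma vnormN x : N (- x) = N x.
Proof. by rewrite -scaleN1r vnormZ normrN1 mul1r. Qed.

Lemma vnorm_ge0 x : 0 <= N x.
Proof.
have := vnorm_triangle x (- x); rewrite subrr vnorm0 vnormN.
by rewrite -mulr2n pmulrn_lge0.
Qed.

Lemma vnorm_eq0 x : N x <= 0 -> x = 0.
Proof.
move=> x0; case: hN => h _ _; apply: h; apply/eqP.
by rewrite eq_le x0 vnorm_ge0.
Qed.

Lemma vnormB x y : N (x - y) <= N x + N y.
Proof. by rewrite -(vnormN y); exact: vnorm_triangle. Qed.

Lemma vnorm_distC x y : N (x - y) = N (y - x).
Proof. by rewrite -vnormN opprB. Qed.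

Lemma vnorm_triangle3 z x y : N (x - y) <= N (x - z) + N (z - y).
Proof. by rewrite (le_trans _ (vnorm_triangle _ _))// addrA subrK. Qed.

Lemma vnorm_sum (I : Type) (r : seq I) (Q : pred I) (F : I -> 'rV[R]_d) :
  N (\sum_(i <- r | Q i) F i) <= \sum_(i <- r | Q i) N (F i).
Proof.
elim/big_ind2 : _ => //; first by rewrite vnorm0.
by move=> x a y b xa yb; rewrite (le_trans (vnorm_triangle _ _))// lerD.
Qed.

Lemma vnorm_le_mx_norm : exists2 L : R, 0 < L & forall x, N x <= L * `|x|.
Proof.
pose S := \sum_(j < d) N (delta_mx 0 j).
have S0 : 0 <= S by apply: sumr_ge0 => j _; exact: vnorm_ge0.
exists (1 + S); first by rewrite ltr_pwDl.
move=> x; rewrite {1}(row_sum_delta x) (le_trans (vnorm_sum _ _ _))//.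
rewrite (@le_trans _ _ (S * `|x|))//; last by rewrite ler_wpM2r// lerDr.
rewrite mulr_suml ler_sum// => j _; rewrite vnormZ mulrC ler_wpM2l ?vnorm_ge0//.
rewrite [leRHS]/Num.Def.normr/= mx_normrE.
by rewrite (le_trans _ (le_bigmax _ _ (0, j))).
Qed.

(** All norms on a finite-dimensional space are continuous, so that limits for the
sup norm carry over to estimates in the norm of the equation. *)
Lemma cvg_vnorm (T : Type) (F : set_system T) (FF : Filter F) (g : T -> 'rV[R]_d)
    (l : 'rV[R]_d) : g x @[x --> F] --> l ->
  forall e, 0 < e -> \forall x \near F, N (g x - l) < e.
Proof.
move=> gl e e0; have [L L0 NL] := vnorm_le_mx_norm.
have /cvgrPdist_lt/(_ (e / L)) := gl; rewrite divr_gt0// => /(_ isT).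
apply: filterS => x; rewrite distrC ltr_pdivlMr// mulrC => h.
exact: le_lt_trans (NL _) h.
Qed.

Lemma has_deriv_onP (D : set R) (g dg : R -> 'rV[R]_d) (t e : R) :
  has_deriv_on D g dg -> D t -> 0 < e ->
  exists2 a : R, 0 < a & forall x, D x -> `|x - t| < a ->
    N (g x - g t - (x - t) *: dg t) <= e * `|x - t|.
Proof.
move=> gdg Dt e0; have /cvg_vnorm-/(_ _ e0) := gdg _ Dt.
rewrite /within/= => /nbhs_ballP[a/= a0 ha]; exists a => // x Dx xta.
have [->|xt] := eqVneq x t.
  by rewrite !subrr scale0r subrr vnorm0 normr0 mulr0.
have xt0 : x - t != 0 by rewrite subr_eq0.
have := ha x; rewrite /ball/= distrC => /(_ xta xt Dx) h.
rewrite -[g x - g t](scalerKV xt0) -scalerBr vnormZ mulrC.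
by rewrite ler_wpM2r// ltW.
Qed.

(** A mean value inequality for an arbitrary norm needs only local Lipschitz
estimates, centred at each point: they propagate from [a] to the supremum of the
points that they reach, and from there a little further. *)
Lemma local_lipschitz_segment (G : R -> 'rV[R]_d) (a b L : R) : a <= b ->
  (forall s e : R, a <= s <= b -> 0 < e -> exists2 del : R, 0 < del &
     forall x, a <= x <= b -> `|x - s| < del ->
       N (G x - G s) <= (L + e) * `|x - s|) ->
  N (G b - G a) <= L * (b - a).
Proof.
move=> ab loc.
(* It suffices to bound the increment with an arbitrarily small loss. *)
suff H : forall e, 0 < e -> N (G b - G a) <= (L + e) * (b - a).
  apply/ler_addgt0Pr => e e0.
  have e1 : 0 < e / (1 + (b - a)).
    by rewrite divr_gt0// ltr_pwDl// subr_ge0.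
  rewrite (le_trans (H _ e1))// mulrDl lerD2l -mulrA ler_piMr ?(ltW e0)//.
  rewrite mulrC ler_pdivrMr ?ltr_pwDl ?subr_ge0//.
  by rewrite mul1r lerDr.
move=> e e0.
pose S := [set x | a <= x <= b /\ N (G x - G a) <= (L + e) * (x - a)].
have Sa : S a by split; rewrite ?lexx//= !subrr vnorm0 mulr0.
have supS : has_sup S by split; [exists a|exists b => x -[/andP[]]].
pose c := sup S.
have ac : a <= c by apply: ub_le_sup => //; case: supS.
have cb : c <= b by apply: ge_sup; [exists a|move=> x -[/andP[]]].
have [del del0 hc] := loc c e (introT andP (conj ac cb)) e0.
have Sc : S c.
  split; first by rewrite ac.
  have [x [/andP[ax xb] Sx] xc] := sup_adherent del0 supS.
  have xlec : x <= c.
    by apply: ub_le_sup; [case: supS|split => //; rewrite ax].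
  rewrite (le_trans (vnorm_triangle3 (G x) _ _))//.
  have -> : (L + e) * (c - a) = (L + e) * (c - x) + (L + e) * (x - a) by ring.
  rewrite lerD// vnorm_distC.
  have xcE : `|x - c| = c - x by rewrite distrC ger0_norm// subr_ge0.
  rewrite -xcE; apply: hc; first by rewrite ax.
  by rewrite xcE ltrBlDr -ltrBlDl.
have [cbE|cb'] := eqVneq c b; first by move: Sc => [_]; rewrite cbE.
have {}cb : c < b by rewrite lt_neqAle cb'.
pose x := Num.min b (c + del / 2).
have cx : c < x by rewrite lt_min cb/= ltrDl divr_gt0.
have xb : x <= b by rewrite ge_min lexx.
have xd : x <= c + del / 2 by rewrite ge_min lexx orbT.
have ax : a <= x by rewrite (le_trans ac)// ltW.
suff Sx : S x.
  by have := ub_le_sup (proj2 supS) Sx; rewrite leNgt cx.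
split; first by rewrite ax.
rewrite (le_trans (vnorm_triangle3 (G c) _ _))//.
have -> : (L + e) * (x - a) = (L + e) * (x - c) + (L + e) * (c - a) by ring.
rewrite lerD//; last by case: Sc.
have xcE : `|x - c| = x - c by rewrite ger0_norm// subr_ge0 ltW.
rewrite -[in leRHS]xcE; apply: hc; first by rewrite ax.
by rewrite xcE; lra.
Qed.

Lemma mean_value_le (g dg : R -> 'rV[R]_d) (a b m : R) : a <= b ->
  has_deriv_on `[a, b] g dg ->
  (forall t, a <= t <= b -> N (dg t) <= m) -> N (g b - g a) <= m * (b - a).
Proof.
move=> ab gdg dgm; apply: local_lipschitz_segment => // s e sab e0.
have Ds : `[a, b]%classic s by rewrite /= in_itv.
have [del del0 h] := has_deriv_onP gdg Ds e0.
exists del => // x xab xs.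
have Dx : `[a, b]%classic x by rewrite /= in_itv.
rewrite -[g x - g s](subrK ((x - s) *: dg s)).
rewrite (le_trans (vnorm_triangle _ _))// addrC mulrDl lerD ?h//.
by rewrite vnormZ mulrC ler_wpM2r// dgm.
Qed.

Lemma has_deriv_on_subset (D D' : set R) (g dg : R -> 'rV[R]_d) :
  D' `<=` D -> has_deriv_on D g dg -> has_deriv_on D' g dg.
Proof.
move=> DD' gdg t /DD' /gdg h A Ah.
by apply: (@filterS _ (nbhs t) _ _ _ _ (h _ Ah)) => x /= hx xt /DD'; exact: hx.
Qed.

Lemma eq_has_deriv_on (D : set R) (f g dg : R -> 'rV[R]_d) :
  (forall x, D x -> f x = g x) -> has_deriv_on D g dg -> has_deriv_on D f dg.
Proof.
move=> fg gdg t Dt A Ah.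
apply: (@filterS _ (nbhs t) _ _ _ _ (gdg t Dt _ Ah)) => x /= hx xt Dx.
by rewrite !fg//; exact: hx.
Qed.

Lemma has_deriv_on_unique (a b : R) (g dg dg' : R -> 'rV[R]_d) : a < b ->
  has_deriv_on `[a, b] g dg -> has_deriv_on `[a, b] g dg' ->
  forall t, a <= t <= b -> dg t = dg' t.
Proof.
move=> ab h h' t tab; have Dt : `[a, b]%classic t by rewrite /= in_itv.
apply/eqP; rewrite -subr_eq0; apply/eqP/vnorm_eq0/ler_addgt0Pr => e e0.
rewrite add0r; have e2 : 0 < e / 2 by rewrite divr_gt0.
have [del del0 hd] := has_deriv_onP h Dt e2.
have [del' del0' hd'] := has_deriv_onP h' Dt e2.
have [x [Dx xt xd xd']] : exists x, [/\ `[a, b]%classic x, x != t,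
    `|x - t| < del & `|x - t| < del'].
  pose m := Num.min (Num.min del del') (b - a) / 2.
  have m0 : 0 < m by rewrite divr_gt0// !lt_min del0 del0' subr_gt0.
  have md : m < del by rewrite ltr_pdivrMr// !gt_min ltr_pMr// ltr1n.
  have md' : m < del' 
    by rewrite ltr_pdivrMr// !gt_min (_ : del' < del' * 2) ?orbT// ltr_pMr// ltr1n.
  have mab : m <= (b - a) / 2 by rewrite ler_pM2r// ge_min lexx orbT.
  move/andP: tab => [ta tb]; have [tm|tm] := leP t ((a + b) / 2).
    exists (t + m); rewrite /= in_itv/= -subr_eq0.
    have -> : t + m - t = m by ring.
    by rewrite gtr0_norm// gt_eqF//; split => //; apply/andP; split; lra.
  exists (t - m); rewrite /= in_itv/= -subr_eq0.
  have -> : t - m - t = - m by ring.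
  by rewrite normrN gtr0_norm// oppr_eq0 gt_eqF//; split => //; apply/andP; split; lra.
have xt0 : 0 < `|x - t| by rewrite normr_gt0 subr_eq0.
rewrite -(ler_pM2r xt0) mulrC -vnormZ scalerBr.
rewrite (le_trans (vnorm_triangle3 (g x - g t) _ _))//.
rewrite [in leRHS](splitr e) mulrDl lerD ?hd'// vnorm_distC.
exact: hd.
Qed.

End Norms.

(** * Vector-valued derivatives and Taylor expansions *)

Section Derivatives.
Variables (R : realType) (d : nat).
Implicit Types (D : set R) (f g df dg : R -> 'rV[R]_d).

Lemma cvg_within_dnbhs D f (t : R) (l : 'rV[R]_d) :
  f x @[x --> t] --> l -> f x @[x --> within D t^'] --> l.
Proof. by move=> fl A /fl; apply: (@filterS _ (nbhs t)) => x /= Ax _ _. Qed.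

Lemma has_deriv_onD D f g df dg : has_deriv_on D f df -> has_deriv_on D g dg ->
  has_deriv_on D (f + g) (df + dg).
Proof.
move=> hf hg t Dt; rewrite [X in X @ _ --> _](_ : _ =
    (fun x => (x - t)^-1 *: (f x - f t) + (x - t)^-1 *: (g x - g t))); last first.
  by apply/funext => x; rewrite -scalerDr !fctE opprD addrACA.
by apply: cvgD; [exact: hf|exact: hg].
Qed.

Lemma has_deriv_onZ D f df (a : R) : has_deriv_on D f df ->
  has_deriv_on D (a *: f) (a *: df).
Proof.
move=> hf t Dt; rewrite [X in X @ _ --> _](_ : _ =
    (fun x => a *: ((x - t)^-1 *: (f x - f t)))); last first.
  by apply/funext => x; rewrite !fctE -scalerBr !scalerA mulrC.
by apply: cvgZl_tmp; exact: hf.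
Qed.

Lemma has_deriv_on_sum D (I : Type) (r : seq I) (Q : pred I)
    (F dF : I -> R -> 'rV[R]_d) : (forall i, Q i -> has_deriv_on D (F i) (dF i)) ->
  has_deriv_on D (\sum_(i <- r | Q i) F i) (\sum_(i <- r | Q i) dF i).
Proof.
move=> h; elim/big_ind2 : _ => //; last by move=> *; exact: has_deriv_onD.
move=> t Dt; rewrite [X in X @ _ --> _](_ : _ = cst 0); first exact: cvg_cst.
by apply/funext => x; rewrite !fctE subrr scaler0.
Qed.

(** The difference quotient of a polynomial at [t] is itself a polynomial, whose
value at [t] is the derivative. *)
Lemma has_deriv_on_horner D (p : {poly R}) (v : 'rV[R]_d) :
  has_deriv_on D (fun t => p.[t] *: v) (fun t => p^`().[t] *: v).
Proof.
move=> t Dt; have /factor_theorem[q qE] : root (p - p.[t]%:P) t.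
  by rewrite rootE hornerD hornerN hornerC subrr.
have -> : p^`().[t] = q.[t].
  have /(congr1 (fun r => r^`().[t])) := qE.
  rewrite derivB derivC subr0 derivM derivXsubC mulr1 hornerD hornerM.
  by rewrite hornerXsubC subrr mulr0 add0r.
have qcvg : (q.[x] *: v) @[x --> within D t^'] --> q.[t] *: v.
  by apply: cvg_within_dnbhs; apply: cvgZr_tmp; exact: continuous_horner.
move=> W Wq; apply: (@filterS _ (nbhs t) _ _ _ _ (qcvg _ Wq)) => x /= Wx xt Dx.
rewrite -scalerBl scalerA.
have /(congr1 (fun r => r.[x])) := qE.
rewrite hornerD hornerN hornerC hornerM hornerXsubC => ->.
have xt0 : x - t != 0 by rewrite subr_eq0.
by rewrite [_ * (x - t)]mulrC mulKf//; exact: Wx.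
Qed.

End Derivatives.

Section Taylor.
Variables (R : realType) (d : nat) (N : 'rV[R]_d -> R).
Hypothesis hN : is_norm N.

(** By induction: the derivative of the remainder of order [n.+1] of [G 0] is the
remainder of order [n] of [G 1], and the mean value inequality integrates the
bound on the latter. *)
Lemma taylor_le (n : nat) (G : nat -> R -> 'rV[R]_d) (a b m x : R) :
  (forall k, (k < n)%N -> has_deriv_on `[a, b] (G k) (G k.+1)) ->
  (forall t, a <= t <= b -> N (G n t) <= m) -> a <= x <= b ->
  N (G 0%N x - \sum_(k < n) ((x - a) ^+ k / k`!%:R) *: G k a)
    <= m * (x - a) ^+ n.
Proof.
elim: n G x => [|n IH] G x hG Gm /andP[ax xb].
  by rewrite big_ord0 subr0 expr0 mulr1 Gm// ax.
have m0 : 0 <= m.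
  by apply: le_trans (vnorm_ge0 hN _) (Gm a _); rewrite lexx (le_trans ax).
pose p k : {poly R} := k`!%:R^-1 *: ('X - a%:P) ^+ k.
pose r := G 0%N + (-1) *: \sum_(k < n.+1) (fun t => (p k).[t] *: G k a).
pose dr := G 1%N + (-1) *: \sum_(k < n.+1) (fun t => (p k)^`().[t] *: G k a).
have rE t : r t = G 0%N t - \sum_(k < n.+1) ((t - a) ^+ k / k`!%:R) *: G k a.
  rewrite /r !fctE scaleN1r fct_sumE; congr (_ - _).
  by apply: eq_bigr => k _; rewrite /p !hornerE mulrC.
have drE t : dr t = G 1%N t - \sum_(k < n) ((t - a) ^+ k / k`!%:R) *: G k.+1 a.
  rewrite /dr !fctE scaleN1r fct_sumE; congr (_ - _).
  rewrite big_ord_recl /p derivZ expr0 derivC scaler0 horner0 scale0r add0r.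
  apply: eq_bigr => k _; congr (_ *: _).
  rewrite derivZ deriv_exp derivXsubC mul1r lift0/= hornerZ.
  rewrite hornerMn horner_exp hornerXsubC factS natrM invfM -[X in _ * X]mulr_natr.
  by rewrite mulrC mulrA mulfK ?pnatr_eq0.
have hr : has_deriv_on `[a, x] r dr.
  apply: (@has_deriv_on_subset _ _ `[a, b]).
    by apply: subset_itvl; rewrite bnd_simp.
  apply: has_deriv_onD; first exact: hG.
  by apply/has_deriv_onZ/has_deriv_on_sum => k _; exact: has_deriv_on_horner.
have ra : r a = 0.
  rewrite rE big_ord_recl subrr expr0 fact0 divr1 scale1r big1 ?addr0 ?subrr//.
  by move=> k _; rewrite lift0 expr0n mul0r scale0r.
rewrite -rE -[r x]subr0 -ra exprSr mulrA; apply: mean_value_le hr _ => // t.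
move=> /andP[at_ tx]; rewrite drE.
apply: le_trans (IH (fun k => G k.+1) t _ _ _) _.
- by move=> k kn; exact: hG.
- by move=> t' /Gm.
- by rewrite at_ (le_trans tx).
- by rewrite ler_wpM2l// lerXn2r ?nnegrE ?subr_ge0 ?lerD2r// (le_trans at_).
Qed.

Lemma derivs_bounded (n : nat) (G : nat -> R -> 'rV[R]_d) (a b : R) : a <= b ->
  (forall k, (k < n)%N -> has_deriv_on `[a, b] (G k) (G k.+1)) ->
  (exists m, forall t, a <= t <= b -> N (G n t) <= m) ->
  exists2 m, 0 <= m & forall k t, (k <= n)%N -> a <= t <= b -> N (G k t) <= m.
Proof.
move=> ab; elim: n G => [|n IH] G hG [m0 Gm0].
  exists m0; last by move=> [|//] t _; exact: Gm0.
  by apply: le_trans (vnorm_ge0 hN _) (Gm0 a _); rewrite lexx.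
have [] := IH (fun k => G k.+1); first by move=> k kn; exact: hG.
  by exists m0.
move=> m m_ge0 Gm; have mab : 0 <= m * (b - a) by rewrite mulr_ge0// subr_ge0.
exists (m + N (G 0%N a) + m * (b - a)).
  by rewrite !addr_ge0// vnorm_ge0.
move=> [|k] t kn tab; last first.
  by rewrite (le_trans (Gm _ _ _ _))// -addrA lerDl addr_ge0// vnorm_ge0.
rewrite -[G 0%N t](subrK (G 0%N a)) (le_trans (vnorm_triangle hN _ _))//.
rewrite [leRHS]addrAC lerD2r ler_wpDl//.
move/andP: tab => [at_ tb].
rewrite (@le_trans _ _ (m * (t - a)))//; last by rewrite ler_wpM2l// lerB.
apply: (mean_value_le hN at_ (dg := G 1%N)).
  apply: (@has_deriv_on_subset _ _ `[a, b]); last exact: hG.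
  by apply: subset_itvl; rewrite bnd_simp.
move=> t' /andP[at' tt']; apply: Gm => //.
by rewrite at' (le_trans tt').
Qed.

End Taylor.

(** * Histories under the maximum norm *)

Section FunctionSpace.
Variables (R : realType) (d : nat) (r : \bar R).
Hypothesis r0 : (0 <= r)%E.
Implicit Types (f g psi : R -> 'rV[R]_d).

Lemma history0 : history r 0.
Proof. by rewrite /history/= lexx; split => //; rewrite leeNl oppe0. Qed.

Lemma history_le0 x : history r x -> x <= 0.
Proof. by case. Qed.

Lemma history_between x y : history r x -> x <= y -> y <= 0 -> history r y.
Proof. by move=> [rx _] xy y0; split => //; rewrite (le_trans rx)// lee_fin. Qed.

Lemma history_shift x w : history r x -> 0 <= w -> w + x <= 0 ->
  history r (w + x).
Proof. by move=> rx w0; apply: history_between rx _; rewrite lerDr. Qed.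

Lemma in_C_lin (a : R) f g : in_C r f -> in_C r g -> in_C r (a *: f + g).
Proof.
move=> [cf lf] [cg lg]; split.
  apply/subspace_continuousP => x Hx; apply: cvgD.
    by apply: cvgZl_tmp; move/subspace_continuousP : cf; exact.
  by move/subspace_continuousP : cg; exact.
move=> rE; apply: is_cvgD; last exact: lg.
by apply: is_cvgZl_tmp; exact: lf.
Qed.

Lemma in_C_cst (v : 'rV[R]_d) : in_C r (fun=> v).
Proof. by split=> [|_]; [exact: cst_continuous|exact: is_cvg_cst]. Qed.

Lemma in_C0 : in_C r (0 : R -> 'rV[R]_d).
Proof.
have -> : (0 : R -> 'rV[R]_d) = fun=> 0 by exact/funext.
exact: in_C_cst.
Qed.

Lemma in_CD f g : in_C r f -> in_C r g -> in_C r (f + g).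
Proof. by rewrite -[X in X + g](scale1r f); exact: in_C_lin. Qed.

Lemma in_CZ (a : R) f : in_C r f -> in_C r (a *: f).
Proof. by move=> hf; rewrite -[a *: f]addr0; exact: in_C_lin hf in_C0. Qed.

Lemma in_CB f g : in_C r f -> in_C r g -> in_C r (f - g).
Proof.
by move=> hf hg; rewrite addrC -scaleN1r; exact: in_C_lin.
Qed.

Lemma in_C_sum (I : Type) (s : seq I) (Q : pred I) (F : I -> R -> 'rV[R]_d) :
  (forall i, Q i -> in_C r (F i)) -> in_C r (\sum_(i <- s | Q i) F i).
Proof.
move=> h; elim/big_ind : _ => [|f g hf hg|i Qi]; last exact: h Qi.
  exact: in_C0.
exact: in_CD hf hg.
Qed.

(** With [in_C_max_shift], this describes functions glued at time [0]: after a shift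
by [w], the history is read off at [Num.min (w + x) 0] and what follows it at
[Num.max (w + x) 0]. *)
Lemma in_C_min_shift f w : 0 <= w -> in_C r f ->
  in_C r (fun x => f (Num.min (w + x) 0)).
Proof.
move=> w0 [cf lf]; split.
  apply/subspace_continuousP => x Hx A Ah.
  have Hm y : history r y -> history r (Num.min (w + y) 0).
    move=> Hy; case: leP => // wy; last exact: history0.
    exact: history_shift.
  move/subspace_continuousP : cf => /(_ _ (Hm _ Hx) _ Ah) h.
  have hc : (Num.min (w + y) 0) @[y --> x] --> Num.min (w + x) 0.
    apply: continuous_min; [|exact: cvg_cst].
    by apply: cvgD; [exact: cvg_cst|exact: cvg_id].
  by apply: (@filterS _ (nbhs x) _ _ _ _ (hc _ h)) => y /= hy /Hm; exact: hy.
move=> rE; apply/cvg_ex; exists (lim (f x @[x --> -oo])) => A Ah.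
have [M [Mr hM]] := lf rE _ Ah.
exists (Num.min M 0 - w); split; first exact: num_real.
move=> x; rewrite ltrBrDl lt_min => /andP[xM x0].
by apply: hM; rewrite /= min_l// ltW.
Qed.

Lemma in_C_max_shift g w : continuous g ->
  in_C r (fun x => g (Num.max (w + x) 0)).
Proof.
move=> cg; split.
  apply: continuous_subspaceT => x; apply: continuous_comp; last exact: cg.
  apply: continuous_max; [|exact: cvg_cst].
  by apply: cvgD; [exact: cvg_cst|exact: cvg_id].
move=> _; apply/cvg_ex; exists (g 0) => A /nbhs_singleton Ah.
exists (- w); split; first exact: num_real.
by move=> x xw; rewrite /= max_r// -lerBrDl sub0r ltW.
Qed.

Variable N : 'rV[R]_d -> R.
Hypothesis hN : is_norm N.

Lemma continuous_segment_bounded f (a b : R) : {within `[a, b], continuous f} ->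
  exists2 m, 0 <= m & forall x, a <= x <= b -> N (f x) <= m.
Proof.
move=> cf; have [L L0 NL] := vnorm_le_mx_norm hN.
have /compact_bounded[M0 [_ hM]] :=
  continuous_compact cf (segment_compact (a := a) (b := b)).
exists (L * (`|M0| + 1)); first by rewrite mulr_ge0 ?ltW// addr_ge0.
move=> x xab; rewrite (le_trans (NL _))// ler_wpM2l ?(ltW L0)//.
have h : M0 < `|M0| + 1 by rewrite (le_lt_trans (ler_norm _))// ltrDl.
by apply: (hM _ h); exists x => //; rewrite /= in_itv.
Qed.

(** The maximum norm is defined as a supremum over the reals, hence is meaningful
only for bounded functions. For an infinite delay it is the limit at minus
infinity that bounds the function outside of a compact interval. *)
Lemma in_C_bounded f : in_C r f ->
  exists m, forall x, history r x -> N (f x) <= m.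
Proof.
move=> [cf lf].
have bnd a : `[a, 0]%classic `<=` history r ->
    exists2 m, 0 <= m & forall x, a <= x <= 0 -> N (f x) <= m.
  move=> aH; apply: continuous_segment_bounded.
  exact: continuous_subspaceW aH cf.
case: r r0 lf bnd => [r1|_ /(_ erefl) lf bnd|//]; rewrite ?lee_fin.
- move=> r10 lf bnd; have [|m _ hm] := bnd (- r1).
    by move=> x /=; rewrite in_itv/= => /andP[rx x0]; split.
  by exists m => x [/= rx x0]; apply: hm; rewrite -lee_fin EFinN rx.
- have [M [Mr hM]] := cvg_vnorm hN _ lf ltr01.
  have [|m m0 hm] := bnd (M - 1).
    by move=> x /=; rewrite in_itv/= => /andP[rx x0]; split => //=; rewrite leNye.
  exists (m + (1 + N (lim (f x @[x --> -oo])))) => x [_ x0].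
  have [Mx|xM] := leP (M - 1) x.
    by rewrite (le_trans (hm _ _)) ?Mx// lerDl addr_ge0// vnorm_ge0.
  rewrite ler_wpDl// -[f x](subrK (lim (f x @[x --> -oo]))).
  rewrite (le_trans (vnorm_triangle hN _ _))// lerD2r ltW// hM//.
  by rewrite (lt_trans xM)// gtrBl.
Qed.

Lemma le_maxnorm f x : in_C r f -> history r x -> N (f x) <= maxnorm N r f.
Proof.
move=> /in_C_bounded[m hm] Hx; apply: ub_le_sup; last by exists x.
by exists m => _ [y Hy <-]; exact: hm.
Qed.

Lemma maxnorm_le f (m : R) : (forall x, history r x -> N (f x) <= m) ->
  maxnorm N r f <= m.
Proof.
move=> hm; apply: ge_sup; first by exists (N (f 0)), 0 => //; exact: history0.
by move=> _ [y Hy <-]; exact: hm.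
Qed.

Lemma maxnorm_ge0 f : in_C r f -> 0 <= maxnorm N r f.
Proof. by move=> /le_maxnorm/(_ history0); apply: le_trans; exact: vnorm_ge0. Qed.

Lemma maxnormD f g : in_C r f -> in_C r g ->
  maxnorm N r (f + g) <= maxnorm N r f + maxnorm N r g.
Proof.
move=> hf hg; apply: maxnorm_le => x Hx.
by rewrite (le_trans (vnorm_triangle hN _ _))// lerD// le_maxnorm.
Qed.

Lemma maxnormZ_le (a : R) f : in_C r f ->
  maxnorm N r (a *: f) <= `|a| * maxnorm N r f.
Proof.
move=> hf; apply: maxnorm_le => x Hx.
by rewrite (vnormZ hN) ler_wpM2l// le_maxnorm.
Qed.

End FunctionSpace.

(** * Increments of the right-hand side *)

Section LinearOnC.
Variables (R : realType) (d : nat) (r : \bar R) (T : (R -> 'rV[R]_d) -> 'rV[R]_d).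
Hypothesis linT : forall (a : R) psi chi, in_C r psi -> in_C r chi ->
  T (a *: psi + chi) = a *: T psi + T chi.

Lemma linC0 : T 0 = 0.
Proof.
have := linT 1 (in_C0 _ r) (in_C0 _ r).
rewrite !scale1r addr0.
by move/eqP; rewrite -subr_eq subrr eq_sym => /eqP.
Qed.

Lemma linCZ (a : R) psi : in_C r psi -> T (a *: psi) = a *: T psi.
Proof.
move=> hpsi; rewrite -[a *: psi]addr0 (linT a hpsi (in_C0 _ r)).
by rewrite linC0 addr0.
Qed.

Lemma linCD psi chi : in_C r psi -> in_C r chi -> T (psi + chi) = T psi + T chi.
Proof. by move=> h h'; rewrite -[in LHS](scale1r psi) linT// scale1r. Qed.

Lemma linC_sum (I : Type) (s : seq I) (Q : pred I) (F : I -> R -> 'rV[R]_d) :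
  (forall i, Q i -> in_C r (F i)) ->
  T (\sum_(i <- s | Q i) F i) = \sum_(i <- s | Q i) T (F i).
Proof.
move=> h; elim: s => [|i s IH]; first by rewrite !big_nil linC0.
rewrite !big_cons; case: ifPn => // Qi.
by rewrite linCD ?IH//; [exact: h|exact: in_C_sum].
Qed.

End LinearOnC.

Section Increments.
Variables (R : realType) (d : nat) (N : 'rV[R]_d -> R) (r : \bar R).
Hypotheses (hN : is_norm N) (r0 : (0 <= r)%E).
Local Notation nrm := (maxnorm N r).

(** The mean value inequality along the segment from [phi] to [phi + psi], with a
comparison vector [w]: taking [w = 0] gives a Lipschitz bound, taking the
derivative at [phi] a bound on the remainder of second order. The factor [kappa]
serves the derivative of [f1], whose modulus also carries the norm of the
argument of [f1]. *)
Lemma increment_le (Dom : set (R -> 'rV[R]_d)) (H : (R -> 'rV[R]_d) -> 'rV[R]_d)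
    (T : (R -> 'rV[R]_d) -> (R -> 'rV[R]_d) -> 'rV[R]_d)
    phi psi (w : 'rV[R]_d) (kappa L : R) :
  in_C r psi -> 0 <= kappa ->
  (forall s : R, 0 <= s <= 1 -> Dom (phi + s *: psi)) ->
  (forall f, Dom f -> forall (a : R) psi chi, in_C r psi -> in_C r chi ->
     T f (a *: psi + chi) = a *: T f psi + T f chi) ->
  (forall f, Dom f -> forall e : R, 0 < e -> exists2 a : R, 0 < a &
     forall chi, Dom (f + chi) -> in_C r chi -> nrm chi < a ->
       N (H (f + chi) - H f - T f chi) <= e * nrm chi * kappa) ->
  (forall s : R, 0 <= s <= 1 -> N (T (phi + s *: psi) psi - w) <= L) ->
  N (H (phi + psi) - H phi - w) <= L.
Proof.
move=> Cpsi k0 hD lin hT hL.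
pose G s := H (phi + s *: psi) - s *: w.
have -> : H (phi + psi) - H phi - w = G 1 - G 0.
  by rewrite /G scale1r scale0r addr0 scale1r scale0r subr0 addrAC.
rewrite -[L]mulr1 -[X in L * X]subr0.
apply: (local_lipschitz_segment hN ler01) => s e s01 e0.
pose q := 1 + nrm psi * kappa.
have psi0 : 0 <= nrm psi by exact: maxnorm_ge0.
have q0 : 0 < q by rewrite ltr_pwDl// mulr_ge0.
have q1 : 0 < 1 + nrm psi by rewrite ltr_pwDl.
have [a a0 ha] := hT _ (hD _ s01) (e / q) (divr_gt0 e0 q0).
exists (a / (1 + nrm psi)); first exact: divr_gt0.
move=> x x01 xs.
have Cx : in_C r ((x - s) *: psi) by exact: in_CZ.
have xE : phi + x *: psi = phi + s *: psi + (x - s) *: psi.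
  by rewrite -addrA -scalerDl addrCA subrr addr0.
have nx : nrm ((x - s) *: psi) <= `|x - s| * nrm psi by exact: maxnormZ_le.
have lta : nrm ((x - s) *: psi) < a.
  rewrite (le_lt_trans nx)// (@le_lt_trans _ _ (`|x - s| * (1 + nrm psi)))//.
    by rewrite ler_wpM2l// lerDr.
  by rewrite -ltr_pdivlMr.
have := ha _ _ Cx lta; rewrite -xE => /(_ (hD _ x01)) h.
have -> : G x - G s = (H (phi + x *: psi) - H (phi + s *: psi)
    - T (phi + s *: psi) ((x - s) *: psi))
  + (x - s) *: (T (phi + s *: psi) psi - w).
  rewrite (linCZ (lin _ (hD _ s01)))// scalerBr addrA subrK /G.
  rewrite scalerBl !opprB addrACA [RHS]addrACA; congr (_ + _).
  by rewrite addrC.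
rewrite (le_trans (vnorm_triangle hN _ _))// addrC mulrDl lerD//.
  by rewrite vnormZ// mulrC ler_wpM2r// hL.
rewrite (le_trans h)// (@le_trans _ _ (e / q * (`|x - s| * nrm psi) * kappa))//.
  by rewrite ler_wpM2r// ler_wpM2l// ltW// divr_gt0.
have -> : e / q * (`|x - s| * nrm psi) * kappa
    = e * `|x - s| * (nrm psi * kappa / q) by ring.
rewrite ler_piMr ?mulr_ge0 ?(ltW e0)// ler_pdivrMr// mul1r.
by rewrite /q lerDr.
Qed.

End Increments.

Section RhsEstimates.
Variables (R : realType) (d : nat) (P : rfde R d).
Hypothesis hP : is_rfde P.
Local Notation N := (vnorm P).
Local Notation nrm := (norm_C P).
Local Notation C := (in_C (delay P)).

Lemma rfde_norm : is_norm N. Proof. by case: hP. Qed.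
Lemma rfde_delay_ge0 : (0 <= delay P)%E. Proof. by case: hP => _ []. Qed.
Hint Resolve rfde_norm rfde_delay_ge0 : core.

(** The remainder is quadratic because [f1] is Lipschitz in the state, which is the
same mean value inequality applied to [f1] and its bounded derivative [f2]. *)
Lemma rhs_estimates f1 f2 : is_rhs_deriv1 P f1 -> is_rhs_deriv2 P f1 f2 ->
  exists2 M : R, 0 <= M &
  [/\ forall t phi psi, domain P (t, phi) -> C psi ->
        N (f1 t phi psi) <= M * nrm psi,
      forall t phi psi, C psi ->
        (forall s : R, 0 <= s <= 1 -> domain P (t, phi + s *: psi)) ->
        N (rhs P t (phi + psi) - rhs P t phi) <= M * nrm psi
    & forall t phi psi, C psi ->
        (forall s : R, 0 <= s <= 1 -> domain P (t, phi + s *: psi)) ->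
        N (rhs P t (phi + psi) - rhs P t phi - f1 t phi psi)
          <= M * nrm psi ^+ 2].
Proof.
move=> [lin1 [M1 hM1] der1 _] [lin2 [M2 hM2] der2 _].
exists (`|M1| + `|M2|); first exact: addr_ge0.
have f1_le t phi psi : domain P (t, phi) -> C psi ->
    N (f1 t phi psi) <= (`|M1| + `|M2|) * nrm psi.
  move=> D Cpsi; rewrite (le_trans (hM1 _ _ D _ Cpsi))//.
  by rewrite ler_wpM2r ?maxnorm_ge0// ler_wpDr// ler_norm.
have der1' t f : domain P (t, f) -> forall e : R, 0 < e -> exists2 a : R, 0 < a &
     forall chi, domain P (t, f + chi) -> C chi -> nrm chi < a ->
       N (rhs P t (f + chi) - rhs P t f - f1 t f chi) <= e * nrm chi * 1.
  move=> Df e e0; have [a a0 ha] := der1 _ _ Df _ e0.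
  by exists a => // chi *; rewrite mulr1; exact: ha.
split => // t phi psi Cpsi hD.
- rewrite -[_ - _]subr0.
  apply: (increment_le (Dom := [set f | domain P (t, f)]) rfde_norm _ Cpsi ler01
    hD (lin1 t) (der1' t)) => // s s01.
  by rewrite subr0 f1_le//; exact: hD.
- apply: (increment_le (Dom := [set f | domain P (t, f)]) rfde_norm _ Cpsi ler01
    hD (lin1 t) (der1' t)) => // s s01.
  rewrite -[_ - _]subr0.
  have Cs : C (s *: psi) by exact: in_CZ.
  have hs : nrm (s *: psi) <= nrm psi.
    rewrite (le_trans (maxnormZ_le _ _ _ _))//; move/andP: s01 => [s0 s1].
    by rewrite ger0_norm// ler_piMl// maxnorm_ge0.
  have hDs s' : 0 <= s' <= 1 -> domain P (t, phi + s' *: (s *: psi)).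
    move=> /andP[s'0 s'1]; rewrite scalerA; apply: hD.
    by move/andP: s01 => [s0 s1]; rewrite mulr_ge0// mulr_ile1.
  apply: (increment_le (Dom := [set f | domain P (t, f)])
    (H := fun f => f1 t f psi) (T := fun f chi => f2 t f chi psi)
    (kappa := nrm psi) rfde_norm _ Cs _ hDs) => //.
  + exact: maxnorm_ge0.
  + by move=> f Df a psi' chi Cpsi' Cchi; have [] := lin2 _ _ Df a _ _ _ Cpsi' Cchi Cpsi.
  + move=> f Df e e0; have [a a0 ha] := der2 _ _ Df _ e0.
    by exists a => // chi Dchi Cchi chia; exact: ha.
  + move=> s' s'01; rewrite subr0 (le_trans (hM2 _ _ _ _ _ _ _))//; first exact: hDs.
    rewrite -mulrA (@le_trans _ _ (`|M2| * (nrm (s *: psi) * nrm psi)))//.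
      by rewrite ler_wpM2r ?ler_norm// mulr_ge0// maxnorm_ge0.
    rewrite expr2 ler_pM// ?mulr_ge0 ?maxnorm_ge0// ?lerDr//.
    by rewrite ler_wpM2r// maxnorm_ge0.
Qed.

End RhsEstimates.

(** * Defects of quadratures *)

Lemma uniform_bound (R : realType) (I : finType) (U : Type) (D : I -> U -> Prop)
    (F : I -> U -> R) :
  (forall i, exists W, forall x, D i x -> F i x <= W) ->
  exists2 W, 0 <= W & forall i x, D i x -> F i x <= W.
Proof.
move=> /choice[W hW]; exists (\sum_i `|W i|).
  by apply: sumr_ge0 => i _; exact: normr_ge0.
move=> i x Dx; rewrite (le_trans (hW _ _ Dx))// (le_trans (ler_norm _))//.
rewrite (bigD1 i)//= lerDl; apply: sumr_ge0 => j _; exact: normr_ge0.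
Qed.

Lemma horner_bounded (R : realType) (p : {poly R}) (X : R) :
  exists W, forall x, 0 <= x <= X -> `|p.[x]| <= W.
Proof.
elim/poly_ind : p => [|p c [W hW]].
  by exists 0 => x _; rewrite horner0 normr0.
exists (W * X + `|c|) => x /andP[x0 xX].
rewrite hornerMXaddC (le_trans (ler_normD _ _))// lerD2r normrM.
by rewrite ler_pM// ?hW ?x0// ger0_norm.
Qed.

Section Quadrature.
Variables (R : realType) (d : nat) (N : 'rV[R]_d -> R).
Hypothesis hN : is_norm N.

(** Comparing Taylor expansions of order [n] at [a], a quadrature of the second
derivative [G 2] with nodes [c j * h] and weights [w j], which stands for an
[l]-fold integral, reproduces [G (2 - l)] up to its defects on monomials. The
case [l = 2] covers [eta] and the stage functions, the case [l = 1] covers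
[eta']. *)
Lemma quadrature_defect (s : nat) (c w : 'I_s -> R) (n l : nat)
    (G : nat -> R -> 'rV[R]_d) (a b m h beta : R) :
  (l <= 2)%N -> 0 <= m ->
  (forall k, (k < n.+2)%N -> has_deriv_on `[a, a + b] (G k) (G k.+1)) ->
  (forall k t, (k <= n.+2)%N -> a <= t <= a + b -> N (G k t) <= m) ->
  0 <= h -> (forall j, 0 <= c j * h <= b) -> (forall j, 0 <= c j) ->
  0 <= beta -> beta * h <= b ->
  N (\sum_(i < l) ((beta * h) ^+ i / i`!%:R) *: G (2 - l + i)%N a
     + h ^+ l *: (\sum_j w j *: G 2%N (a + c j * h)) - G (2 - l)%N (a + beta * h)
     - \sum_(k < n) (h ^+ (k + l) / k`!%:R * (\sum_j w j * c j ^+ k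
          - k`!%:R / (k + l)`!%:R * beta ^+ (k + l))) *: G k.+2 a)
  <= (\sum_j `|w j| * c j ^+ n + beta ^+ (n + l)) * m * h ^+ (n + l).
Proof.
move=> l2 m0 hG Gm h0 ch c0 beta0 bh.
have T1 j : N (G 2%N (a + c j * h)
    - \sum_(k < n) ((c j * h) ^+ k / k`!%:R) *: G k.+2 a) <= m * (c j * h) ^+ n.
  move/andP: (ch j) => [cj0 cjb].
  have := @taylor_le _ _ _ hN n (fun k => G k.+2) a (a + b) m (a + c j * h).
  rewrite (_ : a + c j * h - a = c j * h); last by rewrite addrAC subrr add0r.
  apply.
  - by move=> k kn; exact: hG.
  - by move=> t tab; exact: Gm.
  - by rewrite lerDl cj0 lerD2l.
have T2 : N (G (2 - l)%N (a + beta * h)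
    - \sum_(i < l + n) ((beta * h) ^+ i / i`!%:R) *: G (2 - l + i)%N a)
    <= m * (beta * h) ^+ (l + n).
  have bh0 : 0 <= beta * h by exact: mulr_ge0.
  have lE k : (2 - l + k < n.+2)%N = (k < l + n)%N.
    by rewrite -[n.+2]/(2 + n)%N -{2}(subnK l2) -addnA ltn_add2l.
  have := @taylor_le _ _ _ hN (l + n) (fun k => G (2 - l + k)%N) a (a + b) m
    (a + beta * h).
  rewrite (_ : a + beta * h - a = beta * h); last by rewrite addrAC subrr add0r.
  rewrite addn0; apply.
  - by move=> k kn; rewrite addnS; apply: hG; rewrite lE.
  - move=> t tab; apply: Gm => //; rewrite addnA subnK//.
  - by rewrite lerDl bh0 lerD2l.
set X := (X in N X <= _).
have -> : X = h ^+ l *: (\sum_j w j *: (G 2%N (a + c j * h)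
    - \sum_(k < n) ((c j * h) ^+ k / k`!%:R) *: G k.+2 a))
  - (G (2 - l)%N (a + beta * h)
    - \sum_(i < l + n) ((beta * h) ^+ i / i`!%:R) *: G (2 - l + i)%N a).
  rewrite /X big_split_ord/= opprB [RHS]addrA.
  under [X in _ = h ^+ l *: X + _ - _]eq_bigr do rewrite scalerBr.
  rewrite [in RHS]big_split/= scalerDr.
  have -> : \sum_(k < n) ((beta * h) ^+ (l + k) / (l + k)`!%:R)
        *: G (2 - l + (l + k))%N a
      = \sum_(k < n) (h ^+ (k + l) / k`!%:R * (k`!%:R / (k + l)`!%:R
          * beta ^+ (k + l))) *: G k.+2 a.
    apply: eq_bigr => k _; rewrite addnA subnK// add2n; congr (_ *: _).
    rewrite [(l + k)%N]addnC exprMn.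
    have kf : k`!%:R != 0 :> R by rewrite pnatr_eq0 -lt0n fact_gt0.
    by field; rewrite kf pnatr_eq0 -lt0n fact_gt0.
  have -> : h ^+ l *: (\sum_j (- (w j *: \sum_(k < n)
          ((c j * h) ^+ k / k`!%:R) *: G k.+2 a)))
      = - \sum_(k < n) (h ^+ (k + l) / k`!%:R * \sum_j w j * c j ^+ k)
          *: G k.+2 a.
    rewrite sumrN scalerN; congr (- _); rewrite scaler_sumr.
    under eq_bigr do rewrite scalerA scaler_sumr.
    rewrite exchange_big/=; apply: eq_bigr => k _.
    rewrite mulr_sumr scaler_suml; apply: eq_bigr => j _.
    rewrite scalerA; congr (_ *: _); rewrite exprMn exprD.
    have kf : k`!%:R != 0 :> R by rewrite pnatr_eq0 -lt0n fact_gt0.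
    by field.
  under [X in _ - X]eq_bigr do rewrite mulrBr scalerBl.
  rewrite big_split/= sumrN opprD opprK.
  rewrite -!addrA addrCA; congr (_ + _); rewrite [RHS]addrCA; congr (_ + _).
  by rewrite [LHS]addrC -addrA.
rewrite (le_trans (vnormB hN _ _))// mulrDl mulrDl lerD//; last first.
  by rewrite (le_trans T2)// exprMn addnC mulrA [m * _]mulrC.
rewrite vnormZ// ger0_norm ?exprn_ge0//.
rewrite exprD mulrA [leRHS]mulrC ler_wpM2l ?exprn_ge0//.
rewrite (le_trans (vnorm_sum hN _ _ _))// !mulr_suml ler_sum// => j _.
rewrite vnormZ// -!mulrA ler_wpM2l// (le_trans (T1 j))// exprMn.
by rewrite mulrCA mulrA.
Qed.

End Quadrature.

(** * The solution near its initial point *)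

(** Breaking points are locally finite: there is none immediately after the initial
time, even if the initial time itself is one. *)
Lemma finite_set_right_gap (R : realType) (B : set R) (a b0 : R) : a < b0 ->
  finite_set (B `&` `[a, b0]) ->
  exists b, [/\ a < b, b <= b0 & B `&` `]a, b[ = set0].
Proof.
move=> ab0 /finite_seqP[s sE].
exists (\big[Num.min/b0]_(x <- s | a < x) x); split.
- by elim/big_rec : _ => // x y ax ay; rewrite lt_min ax.
- exact: bigmin_le_id.
- apply/seteqP; split => // x [Bx]; rewrite /= in_itv/= => /andP[ax xb].
  have xs : x \in s.
    have : (B `&` `[a, b0]) x.
      split => //; rewrite /= in_itv/= ltW//= ltW//.
      exact: lt_le_trans xb (bigmin_le_id _ _ _ _).
    by rewrite sE.
  by move: xb; rewrite ltNge (@ge_bigmin_seq _ _ _ _ b0 x (fun y => a < y) id).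
Qed.

Section LocalSolution.
Variables (R : realType) (P : problem R).
Local Notation N := (vnorm (equation P)).
Local Notation r := (delay (equation P)).
Local Notation sig := (sigma P).

Lemma problem_norm : is_norm N. Proof. exact: rfde_norm (equationP P). Qed.
Lemma problem_delay_ge0 : (0 <= r)%E.
Proof. exact: rfde_delay_ge0 (equationP P). Qed.
Hint Resolve problem_norm problem_delay_ge0 : core.

Lemma sol_history theta : history r theta -> sol P (sig + theta) = phi P theta.
Proof. by case: (Defs.solP P) => _ [+ _] _ _ _ => /[apply]. Qed.

Lemma sol_sigma : sol P sig = phi P 0.
Proof. by have := sol_history (history0 problem_delay_ge0); rewrite addr0. Qed.

Lemma dsol_sigma : dsol P sig = dphi P 0.
Proof. by case: (Defs.solP P) => _ []. Qed.

Lemma sol_segment t : sig <= t -> (t%:E < tbar P)%E ->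
  domain (equation P) (t, segment_at (sol P) t) /\
  in_C1 r (segment_at (sol P) t) (segment_at (dsol P) t).
Proof. by move=> st tb; case: (Defs.solP P) => _ _ _ + _; apply. Qed.

Lemma solution_interval_shift theta x : history r theta ->
  sig + theta <= x -> (x%:E < tbar P)%E -> solution_interval r sig (tbar P) x.
Proof.
move=> [rt t0] tx xb; split => //.
by rewrite (@le_trans _ _ (sig + theta)%:E)// EFinD leeD2l.
Qed.

(** By uniqueness of derivatives on a nondegenerate interval, the derivatives
provided by piecewise smoothness agree with [dsol] and with the right-hand side
along the solution. *)
Lemma local_smoothness n : solution_piecewise_class_C n.+2 P ->
  exists (b : R) (G : nat -> R -> 'rV[R]_(Defs.dim P)) (m : R),
  [/\ 0 < b, 0 <= m, ((sig + b)%:E < tbar P)%E &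
   [/\ forall k, (k < n.+2)%N -> has_deriv_on `[sig, sig + b] (G k) (G k.+1),
      forall t, sig <= t <= sig + b -> [/\ G 0%N t = sol P t, G 1%N t = dsol P t
          & G 2%N t = rhs (equation P) t (segment_at (sol P) t)]
    & forall k t, (k <= n.+2)%N -> sig <= t <= sig + b -> N (G k t) <= m]].
Proof.
move=> [B [Bfin Bsm]]; have [stb _ hsol _ hdsol] := Defs.solP P.
have H0 : history r 0 by exact: history0.
have [b0 [sb0 b0t]] : exists b0, sig < b0 /\ (b0%:E < tbar P)%E.
  case: (tbar P) stb => [t| |//]; rewrite ?lte_fin => st.
    by exists ((sig + t) / 2); rewrite lte_fin; split; lra.
  by exists (sig + 1); rewrite ltry ltrDl.
have sub b : b <= b0 ->
    `[sig, b]%classic `<=` solution_interval r sig (tbar P).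
  move=> bb0 x /=; rewrite in_itv/= => /andP[sx xb].
  apply: (solution_interval_shift H0); rewrite ?addr0//.
  by rewrite (le_lt_trans _ b0t)// lee_fin (le_trans xb).
have [b [sb bb0 Bb]] := finite_set_right_gap sb0 (Bfin _ _ (sub _ (lexx _))).
have [G [G0 hG Gn]] := Bsm _ _ sb (sub _ bb0) Bb.
have Dom t : sig <= t <= b -> [set` `[sig, b]] t by rewrite /= in_itv.
have G1 t : sig <= t <= b -> G 1%N t = dsol P t.
  move=> tb; apply: (has_deriv_on_unique problem_norm sb (hG 0%N isT) _ tb).
  apply: eq_has_deriv_on G0 _.
  exact: has_deriv_on_subset (sub _ bb0) hsol.
have G2 t : sig <= t <= b -> G 2%N t = rhs (equation P) t (segment_at (sol P) t).
  move=> tb.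
  apply: (has_deriv_on_unique (dg' := fun t => rhs (equation P) t _)
    problem_norm sb (hG 1%N isT) _ tb).
  apply: (@eq_has_deriv_on _ _ _ _ (dsol P)).
    by move=> x /=; rewrite in_itv; exact: G1.
  apply: has_deriv_on_subset hdsol => x /=; rewrite in_itv/= => /andP[sx xb].
  by split => //; rewrite (le_lt_trans _ b0t)// lee_fin (le_trans xb).
have [mn _ Gmn] := continuous_segment_bounded problem_norm Gn.
have [m m0 Gm] := derivs_bounded problem_norm (ltW sb) hG (ex_intro _ mn Gmn).
exists (b - sig), G, m; rewrite addrCA subrr addr0 subr_gt0; split => //.
  by rewrite (le_lt_trans _ b0t)// lee_fin.
split => // t tb; split; [by apply/G0/Dom|exact: G1|exact: G2].
Qed.

(** The derivative of the solution is bounded on the initial history, as an element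
of C, and on the first smooth piece. Hence translation by [t] moves the solution
by [O(t)], uniformly on a possibly infinite history. *)
Lemma segment_sol_lipschitz (b m : R) : ((sig + b)%:E < tbar P)%E ->
  (forall t, sig <= t <= sig + b -> N (dsol P t) <= m) ->
  exists2 L, 0 <= L & forall t, 0 <= t <= b ->
    norm_C (equation P) (segment_at (sol P) (sig + t) - phi P) <= L * t.
Proof.
move=> sbt hm; have [stb _ hsol _ _] := Defs.solP P.
have [_ [_ Cd _]] := sol_segment (lexx sig) stb.
have [m1 hm1] := in_C_bounded problem_delay_ge0 problem_norm Cd.
exists (`|m| + `|m1|); first exact: addr_ge0.
move=> t /andP[t0 tb]; apply: maxnorm_le => // theta Ht.
rewrite !fctE -(sol_history Ht) /segment_at.
have -> : (`|m| + `|m1|) * t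
    = (`|m| + `|m1|) * (sig + t + theta - (sig + theta)) by ring.
have th0 := history_le0 Ht.
apply: (mean_value_le problem_norm (dg := dsol P)); first lra.
  apply: has_deriv_on_subset hsol => x /=; rewrite in_itv/= => /andP[x1 x2].
  apply: (solution_interval_shift Ht x1).
  by rewrite (le_lt_trans _ sbt)// lee_fin; lra.
move=> x /andP[x1 x2]; have [xs|sx] := leP x sig.
  have := hm1 (x - sig) (history_between Ht _ _).
  rewrite /segment_at addrCA subrr addr0 => h.
  rewrite (le_trans (h _ _))//; [lra|lra|].
  by rewrite (le_trans (ler_norm _))// lerDr.
rewrite (le_trans (hm _ _))//; first by apply/andP; split; lra.
by rewrite (le_trans (ler_norm _))// lerDl.
Qed.

End LocalSolution.

(** * Expansion of the stage values and of the local errors *)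

Lemma continuous_horner_div (R : realType) (d : nat) (p : {poly R}) (h : R)
    (v : 'rV[R]_d) : continuous (fun x : R => p.[x / h] *: v).
Proof.
pose q := p \Po (h^-1 *: 'X).
have pq x : p.[x / h] = q.[x] by rewrite horner_comp hornerZ hornerX mulrC.
move=> x; apply: cvgZr_tmp; rewrite pq (_ : (fun y => _) = horner q).
  exact: continuous_horner.
by apply/funext => y; rewrite pq.
Qed.

Section Defects.
Variables (R : realType) (s : nat) (M : fcrkn R s).

(** The error of the quadrature with weights [A M i] for the double integral of the
monomial of degree [k]. The quotient of factorials is 1 / ((k + 1) (k + 2)). *)
Definition stage_defect (k : nat) (i : 'I_s) : {poly R} :=
  \sum_j c M j ^+ k *: A M i j - (k`!%:R / (k + 2)`!%:R) *: 'X^(k + 2).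

Lemma horner_stage_defect k i beta : (stage_defect k i).[beta] =
  \sum_j (A M i j).[beta] * c M j ^+ k - k`!%:R / (k + 2)`!%:R * beta ^+ (k + 2).
Proof.
rewrite /stage_defect hornerD hornerN hornerZ hornerXn horner_sum.
by congr (_ - _); apply: eq_bigr => j _; rewrite hornerZ mulrC.
Qed.

Lemma stage_defect0 k i : (stage_defect k i).[0] = 0.
Proof.
rewrite horner_stage_defect addnS expr0n mulr0 subr0.
by rewrite big1// => j _; rewrite A_at0 mul0r.
Qed.

Variable P : problem R.

(** The maximum with [0] extends the defects by [0] to the history, where a stage
function agrees with the solution: [stage_defect] vanishes at [0]. *)
Definition leading_deviation (gamma : nat -> 'rV[R]_(Defs.dim P)) (h : R)
    (i : 'I_s) : R -> 'rV[R]_(Defs.dim P) :=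
  \sum_(k < 3) (h ^+ (k + 2) / k`!%:R) *:
    (fun theta => (stage_defect k i).[Num.max (c M i * h + theta) 0 / h]
                    *: gamma k).

Lemma in_C_leading_deviation r gamma h i :
  in_C r (leading_deviation gamma h i).
Proof.
apply: in_C_sum => k _; apply: in_CZ.
apply: (@in_C_max_shift _ _ _ (fun x => (stage_defect k i).[x / h] *: gamma k)).
exact: continuous_horner_div.
Qed.

(** The two pieces of a stage function agree at time [0] because [A] vanishes
there. *)
Lemma in_C_stage_segment (h : R) (K : 'I_s -> 'rV[R]_(Defs.dim P)) i : 0 <= h ->
  in_C (delay (equation P)) (segment_at (stage_function M h K i) (c M i * h)).
Proof.
move=> h0; pose q x := x *: dphi P 0
  + \sum_(j < s | (j < i)%N) (A M i j).[x / h] *: (h ^+ 2 *: K j).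
have -> : segment_at (stage_function M h K i) (c M i * h) =
    (fun theta => phi P (Num.min (c M i * h + theta) 0))
    + (fun theta => q (Num.max (c M i * h + theta) 0)).
  apply/funext => theta; rewrite !fctE /segment_at /stage_function /q.
  case: leP => x0.
    by rewrite mul0r scale0r add0r big1 ?addr0// => j _; rewrite A_at0 scale0r.
  rewrite -addrA; congr (_ + (_ + _)); rewrite scaler_sumr.
  by apply: eq_bigr => j _; rewrite !scalerA mulrC.
have cih : 0 <= c M i * h by rewrite mulr_ge0// c_ge0.
apply: in_CD.
  apply: in_C_min_shift => //; first exact: problem_delay_ge0.
  by case: (phi_C1 P).
apply: (@in_C_max_shift _ _ _ q)  => x; apply: cvgD.
  by apply: cvgZr_tmp; exact: cvg_id.
apply: cvg_big; [exact: add_continuous|by move=> j _; exact: continuous_horner_div].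
Qed.

End Defects.

(** The type [T] may be infinite, so the sum is partitioned over the finite type of
the values of [c]. *)
Lemma sum_fibers_eq0 (I : finType) (T : choiceType) (V : nmodType) (c : I -> T)
    (F : I -> V) :
  (forall x, \sum_(i | c i == x) F i = 0) -> \sum_i F i = 0.
Proof.
move=> h; pose p i : seq_sub (codom c) := SeqSub (codom_f c i).
rewrite (partition_big p xpredT)//= big1// => x _.
rewrite -[RHS](h (val x)); apply: eq_bigl => i.
by rewrite -val_eqE.
Qed.

Section StageValues.
Variables (R : realType) (s : nat) (M : fcrkn R s) (P : problem R).
Variable h : R.
Local Notation V := 'rV[R]_(Defs.dim P).

Definition stage_map (K : 'I_s -> V) (i : 'I_s) : V :=
  rhs (equation P) (sigma P + c M i * h)
    (segment_at (stage_function M h K i) (c M i * h)).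

(** The method is explicit: [s] iterations of [stage_map] settle all the stages, from
any starting values. *)
Definition explicit_stages : 'I_s -> V := iter s stage_map (fun=> 0).

Lemma eq_stage_function (K K' : 'I_s -> V) (i : 'I_s) :
  (forall j : 'I_s, (j < i)%N -> K j = K' j) ->
  stage_function M h K i = stage_function M h K' i.
Proof.
move=> KK'; apply/funext => x; rewrite /stage_function; case: ifP => // _.
by congr (_ + _ *: _); apply: eq_bigr => j /KK' ->.
Qed.

Lemma explicit_stagesE i : explicit_stages i = stage_map explicit_stages i.
Proof.
suff H n (j : 'I_s) : (j < n)%N ->
    iter n stage_map (fun=> 0) j = stage_map (iter n stage_map (fun=> 0)) j.
  exact: H.
elim: n j => [//|n IH] {}i; rewrite ltnS leq_eqVlt => ni.
rewrite {1}iterS /stage_map; congr (rhs _ _ (segment_at _ _)).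
apply: eq_stage_function => j ji; rewrite iterS; apply: IH.
by case/predU1P : ni => [<-|]//; exact: ltn_trans.
Qed.

End StageValues.

Section Stages.
Variables (R : realType) (s : nat) (M : fcrkn R s) (P : problem R).
Variables (b m : R) (G : nat -> R -> 'rV[R]_(Defs.dim P)).
Local Notation N := (vnorm (equation P)).
Local Notation r := (delay (equation P)).
Local Notation sig := (sigma P).
Local Notation gamma := (fun k : nat => G k.+2 sig).
Local Notation V := 'rV[R]_(Defs.dim P).
Hypotheses (b0 : 0 < b) (m0 : 0 <= m) (sbt : ((sig + b)%:E < tbar P)%E).
Hypothesis hG : forall k, (k < 7)%N -> has_deriv_on `[sig, sig + b] (G k) (G k.+1).
Hypothesis G012 : forall t, sig <= t <= sig + b ->
  [/\ G 0%N t = sol P t, G 1%N t = dsol P t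
    & G 2%N t = rhs (equation P) t (segment_at (sol P) t)].
Hypothesis Gm : forall k t, (k <= 7)%N -> sig <= t <= sig + b -> N (G k t) <= m.
Hypothesis hA : forall (i : 'I_s) (alpha : R), 0 <= alpha <= c M i ->
  \sum_(j < s) (A M i j).[alpha] = alpha ^+ 2 / 2.
Hint Resolve problem_norm problem_delay_ge0 : core.

(** Replacing the stage values by the values of the second derivative of the solution
costs [h ^+ 2 * h ^+ 3]; with those values the stage function is a quadrature. *)
Lemma stage_deviation (C : R) : 0 <= C -> exists2 C', 0 <= C' &
  forall (i : 'I_s) (h : R) (K : 'I_s -> V), 0 < h -> (forall j, c M j * h <= b) ->
  (forall j : 'I_s, (j < i)%N -> N (K j - G 2%N (sig + c M j * h)) <= C * h ^+ 3) ->
  forall theta, history r theta ->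
  N (segment_at (stage_function M h K i) (c M i * h) theta
     - segment_at (sol P) (sig + c M i * h) theta
     - leading_deviation M gamma h i theta) <= C' * h ^+ 5.
Proof.
move=> C0.
have [W W0 hW] : exists2 W, 0 <= W & forall (ij : 'I_s * 'I_s) x,
    0 <= x <= c M ij.1 -> `|(A M ij.1 ij.2).[x]| <= W.
  apply: uniform_bound => ij; exact: horner_bounded.
(* The first summand bounds the remainders of the two Taylor expansions, the
   second the errors of the preceding stages. *)
pose Q i := (\sum_j W * c M j ^+ 3 + c M i ^+ 5) * m + (\sum_(j < s) W * C).
have c0 i : 0 <= c M i by exact: c_ge0.
have Q0 i : 0 <= Q i.
  by rewrite addr_ge0 ?mulr_ge0 ?addr_ge0 ?exprn_ge0 ?sumr_ge0// => j _;
    rewrite mulr_ge0 ?exprn_ge0.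
exists (\sum_i Q i); first by apply: sumr_ge0.
move=> i h K h0 cb hK theta Ht.
apply: (@le_trans _ _ (Q i * h ^+ 5)); last first.
  rewrite ler_wpM2r ?exprn_ge0 ?(ltW h0)// (bigD1 i)//= lerDl.
  by apply: sumr_ge0.
have hi : 0 <= c M i * h by rewrite mulr_ge0// ltW.
rewrite /leading_deviation fct_sumE /segment_at -[sig + _ + theta]addrA.
set x := c M i * h + theta; rewrite /stage_function; case: ifPn => [x0|].
  rewrite sol_history; last exact: history_shift.
  rewrite subrr sub0r vnormN// big1 ?vnorm0 ?mulr_ge0 ?Q0 ?exprn_ge0 ?(ltW h0)// => k _.
  by rewrite fctE /= max_r// mul0r stage_defect0 scale0r scaler0.
rewrite -ltNge => x0; pose beta := x / h.
have xE : x = beta * h by rewrite /beta divfK// gt_eqF.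
have be0 : 0 <= beta by rewrite divr_ge0// ltW.
have bec : beta <= c M i.
  by rewrite ler_pdivrMr// /x gerDl; exact: history_le0 Ht.
have bh : beta * h <= b by rewrite (le_trans _ (cb i))// ler_wpM2r// ltW.
have c01 j : 0 <= c M j * h <= b by rewrite cb mulr_ge0// ltW.
have hG3 k : (k < 5)%N -> has_deriv_on `[sig, sig + b] (G k) (G k.+1).
  by move=> k5; apply: hG; rewrite (leq_trans k5).
have Gm3 k t : (k <= 5)%N -> sig <= t <= sig + b -> N (G k t) <= m.
  by move=> k5; apply: Gm; rewrite (leq_trans k5).
have := quadrature_defect (n := 3) (l := 2) (problem_norm P)
  (fun j => (A M i j).[beta]) isT m0 hG3 Gm3 (ltW h0) c01 c0 be0 bh.
set Z := (X in N X <= _) => ZB.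
set E := (X in N X <= _).
have sx : sig <= sig + x <= sig + b by rewrite lerDl ltW//= lerD2l xE.
have s0 : sig <= sig <= sig + b by rewrite lexx lerDl ltW.
have -> : E = Z + h ^+ 2 *:
    \sum_j (A M i j).[beta] *: (K j - G 2%N (sig + c M j * h)).
  rewrite /E /Z -xE.
  have [-> _ _] := G012 sx; have [g0 g1 _] := G012 s0.
  have -> : \sum_(i0 < 2) (x ^+ i0 / i0`!%:R) *: G (2 - 2 + i0)%N sig
      = phi P 0 + x *: dphi P 0.
    rewrite !big_ord_recl big_ord0 /= g0 g1 sol_sigma dsol_sigma.
    by rewrite expr0 expr1 !divr1 scale1r addr0.
  have -> : \sum_(j < s | (j < i)%N) (A M i j).[x / h] *: K j
      = \sum_j (A M i j).[beta] *: K j.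
    rewrite big_mkcond/=; apply: eq_bigr => j _; case: ifPn => //.
    by rewrite -leqNgt => ij; rewrite A_strict_lower// horner0 scale0r.
  have -> : \sum_(k < 3) ((h ^+ (k + 2) / k`!%:R) *: (fun theta0 =>
        (stage_defect M k i).[Num.max (c M i * h + theta0) 0 / h] *: gamma k)) theta
      = \sum_(k < 3) (h ^+ (k + 2) / k`!%:R * (\sum_j (A M i j).[beta] * c M j ^+ k
          - k`!%:R / (k + 2)`!%:R * beta ^+ (k + 2))) *: G k.+2 sig.
    apply: eq_bigr => k _; rewrite fctE -/x max_l ?(ltW x0)// -/beta scalerA.
    by rewrite horner_stage_defect.
  have -> : \sum_j (A M i j).[beta] *: (K j - G 2%N (sig + c M j * h))
      = \sum_j (A M i j).[beta] *: K j
        - \sum_j (A M i j).[beta] *: G 2%N (sig + c M j * h).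
    by rewrite -sumrB; apply: eq_bigr => j _; rewrite scalerBr.
  rewrite scalerBr.
  set a1 := phi P 0; set a2 := x *: _; set a3 := h ^+ 2 *: _.
  set a4 := sol P _; set a5 := \sum_k _; set a6 := h ^+ 2 *: _.
  clearbody a1 a2 a3 a4 a5 a6; apply/rowP => j; rewrite !mxE; ring.
rewrite (le_trans (vnorm_triangle (problem_norm P) _ _))// /Q mulrDl lerD//.
  rewrite (le_trans ZB)// ler_wpM2r ?exprn_ge0 ?(ltW h0)// ler_wpM2r// lerD//.
    apply: ler_sum => j _; rewrite ler_wpM2r ?exprn_ge0//.
    by apply: (hW (i, j)); rewrite /= be0.
  by rewrite lerXn2r ?nnegrE.
rewrite vnormZ// ger0_norm ?exprn_ge0 ?(ltW h0)//.
rewrite -[5%N]/(2 + 3)%N exprD mulrA [leRHS]mulrAC [leRHS]mulrC.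
rewrite ler_wpM2l ?exprn_ge0 ?(ltW h0)// (le_trans (vnorm_sum _ _ _ _))//.
rewrite mulr_suml ler_sum// => j _; rewrite vnormZ//.
have [ji|ij] := ltnP j i; last first.
  by rewrite A_strict_lower// horner0 normr0 mul0r !mulr_ge0 ?exprn_ge0 ?(ltW h0).
rewrite -mulrA ler_pM ?vnorm_ge0 ?hK//.
by apply: (hW (i, j)); rewrite /= be0.
Qed.

(** The row condition on [A] removes the term of degree [0], which would be of order
[h ^+ 2]. *)
Lemma leading_deviation_bounded : exists2 C, 0 <= C & forall (i : 'I_s) (h theta : R),
  0 < h <= 1 -> history r theta ->
  N (leading_deviation M gamma h i theta) <= C * h ^+ 3.
Proof.
have [W W0 hW] : exists2 W, 0 <= W & forall (ik : 'I_s * 'I_3) x,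
    0 <= x <= c M ik.1 -> `|(stage_defect M ik.2 ik.1).[x]| <= W.
  apply: uniform_bound => ij; exact: horner_bounded.
exists (\sum_(k < 3) W * m).
  by apply: sumr_ge0 => k _; rewrite mulr_ge0.
move=> i h theta /andP[h0 h1] Ht; rewrite /leading_deviation fct_sumE.
rewrite (le_trans (vnorm_sum _ _ _ _))// mulr_suml ler_sum// => k _.
set x := Num.max (c M i * h + theta) 0 / h.
have xc : 0 <= x <= c M i.
  rewrite divr_ge0 ?le_max ?lexx ?orbT ?(ltW h0)//= ler_pdivrMr// ge_max.
  rewrite gerDl (history_le0 Ht) mulr_ge0 ?c_ge0 ?(ltW h0)//.
have gm : N (gamma k) <= m by apply: Gm; [case: k => -[|[|[|]]]|rewrite lexx lerDl ltW].
rewrite fctE !vnormZ// -/x ger0_norm ?divr_ge0 ?exprn_ge0 ?(ltW h0)//.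
have [->|k0] := eqVneq (k : nat) 0%N.
  rewrite [in X in _ * (X * _)]horner_stage_defect.
  under eq_bigr do rewrite expr0 mulr1.
  by rewrite hA// add0n fact0 mul1r [2`!%:R^-1 * _]mulrC subrr normr0 mul0r mulr0
    !mulr_ge0 ?exprn_ge0 ?(ltW h0).
rewrite mulrC ler_pM ?mulr_ge0 ?vnorm_ge0 ?divr_ge0 ?exprn_ge0 ?(ltW h0)//.
  by rewrite ler_pM ?vnorm_ge0//; apply: (hW (i, k)).
rewrite ler_pdivrMr ?ltr0n ?fact_gt0// (@le_trans _ _ (h ^+ 3))//.
  by rewrite ler_wiXn2l ?(ltW h0)// addn2 !ltnS lt0n.
by rewrite ler_peMr ?exprn_ge0 ?(ltW h0)// ler1n fact_gt0.
Qed.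

Variables (f1 : R -> (R -> V) -> (R -> V) -> V)
  (f2 : R -> (R -> V) -> (R -> V) -> (R -> V) -> V).
Hypotheses (hf1 : is_rhs_deriv1 (equation P) f1)
  (hf2 : is_rhs_deriv2 (equation P) f1 f2).

(** The stage function and the solution both stay in a ball around the initial
function that is contained in the domain, and so does the segment between them;
the estimates on the increments of the right-hand side apply along it. *)
Lemma stage_step (C : R) : 0 <= C -> exists h0 C1 : R, [/\ 0 < h0, 0 <= C1 &
  forall (i : 'I_s) (h : R) (K : 'I_s -> V), 0 < h < h0 ->
  (forall j : 'I_s, (j < i)%N -> N (K j - G 2%N (sig + c M j * h)) <= C * h ^+ 3) ->
  let t := sig + c M i * h in
  let Y := segment_at (stage_function M h K i) (c M i * h) in
  [/\ domain (equation P) (t, Y),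
      N (rhs (equation P) t Y - G 2%N t) <= C1 * h ^+ 3
    & N (rhs (equation P) t Y - G 2%N t
         - f1 t (segment_at (sol P) t) (leading_deviation M gamma h i))
      <= C1 * h ^+ 5]].
Proof.
move=> C0; have [D D0 hD] := stage_deviation C0.
have [B B0 hB] := leading_deviation_bounded.
have [L L0 hL] : exists2 L, 0 <= L & forall t, 0 <= t <= b ->
    norm_C (equation P) (segment_at (sol P) (sig + t) - phi P) <= L * t.
  apply: segment_sol_lipschitz sbt _ => t tb.
  by have [_ <- _] := G012 tb; exact: Gm.
have [F F0 [f1_le rhs_lip rhs_tay]] := rhs_estimates (equationP P) hf1 hf2.
have [e e0 ball] : exists2 e : R, 0 < e & forall t' phi', in_C r phi' ->
    `|t' - sig| < e -> norm_C (equation P) (phi' - phi P) < e ->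
    domain (equation P) (t', phi').
  by case: (equationP P) => _ [_ [_ [+ _]]]; apply; exact: initialP.
pose cs := \sum_j c M j.
have cs0 : 0 <= cs by apply: sumr_ge0 => j _; exact: c_ge0.
have c_le j : c M j <= cs.
  by rewrite /cs (bigD1 j)//= lerDl; apply: sumr_ge0 => k _; exact: c_ge0.
pose E := D + B.
have E0 : 0 <= E by exact: addr_ge0.
(* For [h * q < b] all nodes stay in the smooth piece; for [h * q < e] the
   segment from the solution to the stage function stays in the ball, since
   [L * cs * h] bounds the motion of the solution and [E * h] the deviation. *)
pose q := cs + L * cs + E + 1.
have q0 : 0 < q by rewrite ltr_wpDl// !addr_ge0 ?mulr_ge0.
exists (Num.min 1 (Num.min (b / q) (e / q))), (F * E + F * E ^+ 2 + F * D); split.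
- by rewrite !lt_min ltr01 !divr_gt0.
- by rewrite !addr_ge0 ?mulr_ge0 ?exprn_ge0.
move=> i h K /andP[h0]; rewrite !lt_min => /and3P[h1].
rewrite !ltr_pdivlMr// => hbq heq hK t Y.
have hge0 := ltW h0.
have h3 : h ^+ 3 <= h by rewrite -[leRHS]expr1 ler_wiXn2l// ltW.
have h53 : h ^+ 5 <= h ^+ 3 by rewrite ler_wiXn2l// ltW.
have h65 : h ^+ 6 <= h ^+ 5 by rewrite ler_wiXn2l// ltW.
have ch j : c M j * h <= cs * h by rewrite ler_wpM2r.
have ch0 j : 0 <= c M j * h by rewrite mulr_ge0 ?c_ge0.
have csh : cs * h <= h * q.
  by rewrite mulrC ler_wpM2l// /q -!addrA lerDl !addr_ge0 ?mulr_ge0.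
have cb j : c M j * h <= b by rewrite (le_trans (ch j))// (le_trans csh)// ltW.
have tb : sig <= t <= sig + b by rewrite lerDl ch0 lerD2l cb.
have ttb : (t%:E < tbar P)%E.
  by rewrite (le_lt_trans _ sbt)// lee_fin; case/andP: tb.
have [domS [CS _ _]] := sol_segment (proj1 (andP tb)) ttb.
set S := segment_at (sol P) t in domS CS.
have CY : in_C r Y by exact: in_C_stage_segment.
pose dev := Y - S; pose lead := leading_deviation M gamma h i.
have Cdev : in_C r dev by exact: in_CB CY CS.
have Clead : in_C r lead by exact: in_C_leading_deviation.
have rem_le : norm_C (equation P) (dev - lead) <= D * h ^+ 5.
  by apply: maxnorm_le => // theta Ht; exact: hD.
have lead_le : norm_C (equation P) lead <= B * h ^+ 3.
  by apply: maxnorm_le => // theta Ht; apply: hB => //; rewrite h0 ltW.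
have dev_le : norm_C (equation P) dev <= E * h ^+ 3.
  have := maxnormD (problem_delay_ge0 P) (problem_norm P) (in_CB Cdev Clead) Clead.
  rewrite subrK => /le_trans; apply.
  by rewrite /E mulrDl lerD// (le_trans rem_le)// ler_wpM2l.
have dev0 : 0 <= norm_C (equation P) dev by exact: maxnorm_ge0.
have dom_seg u : 0 <= u <= 1 -> domain (equation P) (t, S + u *: dev).
  move=> /andP[u0 u1]; apply: ball.
  - exact: in_CD CS (in_CZ u Cdev).
  - rewrite /t addrAC subrr add0r ger0_norm// (le_lt_trans _ heq)//.
    by rewrite (le_trans (ch i)).
  - have Cphi : in_C r (S - phi P) by exact: in_CB CS (let: And3 h _ _ := phi_C1 P in h).
    have Cu : in_C r (u *: dev) by exact: in_CZ Cdev.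
    rewrite addrAC.
    apply: le_lt_trans (maxnormD (problem_delay_ge0 P) (problem_norm P) Cphi Cu) _.
    rewrite (le_lt_trans _ heq)// (@le_trans _ _ (L * (cs * h) + E * h))//.
      rewrite lerD//.
        rewrite (le_trans (hL _ _)) ?ch0 ?cb//.
        by rewrite ler_wpM2l.
      have uD := maxnormZ_le (problem_delay_ge0 P) (problem_norm P) u Cdev.
      rewrite (le_trans uD)// ger0_norm//.
      rewrite (@le_trans _ _ (norm_C (equation P) dev))//.
        by rewrite ler_piMl.
      by rewrite (le_trans dev_le)// ler_wpM2l.
    rewrite /q; have : 0 <= h * (cs + 1) by rewrite mulr_ge0// addr_ge0.
    by lra.
have YE : Y = S + dev by rewrite addrC subrK.
have [_ _ G2] := G012 tb; rewrite G2 -/S.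
split.
- by rewrite YE -[dev]scale1r; apply: dom_seg; rewrite ler01 lexx.
- rewrite {1}YE (le_trans (rhs_lip _ _ _ Cdev dom_seg))//.
  rewrite (@le_trans _ _ (F * (E * h ^+ 3)))//; first by rewrite ler_wpM2l.
  rewrite mulrA ler_wpM2r ?exprn_ge0// -addrA lerDl addr_ge0 ?mulr_ge0 ?exprn_ge0//.
- have [lin _ _ _] := hf1.
  have -> : rhs (equation P) t Y - rhs (equation P) t S - f1 t S lead
      = (rhs (equation P) t (S + dev) - rhs (equation P) t S - f1 t S dev)
        + f1 t S (dev - lead).
    have -> : f1 t S dev = f1 t S lead + f1 t S (dev - lead).
      rewrite -(linCD (lin t S domS) Clead (in_CB Cdev Clead)).
      by congr (f1 t S); rewrite addrC subrK.
    by rewrite -YE opprD addrA subrK.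
  have h35 : (E * h ^+ 3) ^+ 2 <= E ^+ 2 * h ^+ 5.
    by rewrite exprMn -exprM ler_wpM2l ?exprn_ge0.
  rewrite (le_trans (vnorm_triangle (problem_norm P) _ _))//.
  rewrite [leRHS]mulrDl [in leRHS]mulrDl -[leRHS]addrA.
  rewrite ler_wpDl ?mulr_ge0 ?exprn_ge0 ?lerD//.
    rewrite (le_trans (rhs_tay _ _ _ Cdev dom_seg))// -mulrA ler_wpM2l//.
    by rewrite (le_trans _ h35)// lerXn2r ?nnegrE ?mulr_ge0 ?exprn_ge0.
  apply: le_trans (f1_le _ _ _ domS (in_CB Cdev Clead)) _.
  by rewrite -mulrA ler_wpM2l.
Qed.

Local Notation t_ h i := (sig + c M i * h).
Local Notation T_ h i := (f1 (t_ h i) (segment_at (sol P) (t_ h i))).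

(** A first induction on the number of stages yields the errors of order [h ^+ 3]
that the expansion of a stage supposes for the preceding ones; the expansion is
then applied to all the stages at once. *)
Lemma stages_exist : exists h0 C : R, [/\ 0 < h0, 0 <= C & forall h, 0 < h < h0 ->
  exists2 K, stage_values M h K & forall i,
    N (K i - G 2%N (t_ h i) - T_ h i (leading_deviation M gamma h i))
    <= C * h ^+ 5].
Proof.
pose K h := explicit_stages M P h.
have /(_ s)[h0 [C [h0_gt0 C0 hC]]] : forall n, exists h0 C : R, [/\ 0 < h0, 0 <= C &
    forall h (i : 'I_s), 0 < h < h0 -> (i < n)%N ->
      N (K h i - G 2%N (t_ h i)) <= C * h ^+ 3].
  elim=> [|n [h0 [C [h0_gt0 C0 hC]]]]; first by exists 1, 0.
  have [h1 [C1 [h1_gt0 C10 hC1]]] := stage_step C0.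
  exists (Num.min h0 h1), C1; rewrite lt_min h0_gt0 h1_gt0; split => // h i.
  rewrite lt_min => /andP[hp /andP[hh0 hh1]] ni.
  have [||_ + _] := hC1 i h (K h); rewrite ?hp//.
    by move=> j ji; apply: hC; [rewrite hp|exact: leq_trans ji _].
  by rewrite /K explicit_stagesE.
have [h1 [C1 [h1_gt0 C10 hC1]]] := stage_step C0.
exists (Num.min h0 h1), C1; rewrite lt_min h0_gt0 h1_gt0; split => // h.
rewrite lt_min => /andP[hp /andP[hh0 hh1]].
have hh1' : 0 < h < h1 by rewrite hp.
have hh0' : 0 < h < h0 by rewrite hp.
have hK i := hC1 i h (K h) hh1' (fun j _ => hC h j hh0' (ltn_ord j)).
exists (K h) => i; first by split; [have [] := hK i|exact: explicit_stagesE].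
by rewrite {1}/K explicit_stagesE; have [] := hK i.
Qed.

(** The stages with abscissa [x] share the linear functional, the derivative of the
right-hand side at time [sig + x * h]. By linearity it is applied to the weighted
sum of their defects, which vanishes on the whole history for the degrees below
[n]. The remaining degrees contribute at least [h ^+ (n + 2)]. *)
Lemma weighted_leading (w : 'I_s -> {poly R}) (n : nat) : (n <= 3)%N ->
  (forall (x alpha beta : R) k, (k < n)%N -> 0 <= alpha <= 1 -> 0 <= beta <= x ->
     \sum_(i | c M i == x) (w i).[alpha] * (stage_defect M k i).[beta] = 0) ->
  exists2 C, 0 <= C & forall h alpha : R, 0 < h <= 1 ->
    (forall i, c M i * h <= b) -> 0 <= alpha <= 1 ->
    N (\sum_i (w i).[alpha] *: T_ h i (leading_deviation M gamma h i))
      <= C * h ^+ (n + 2).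
Proof.
move=> n3 hw.
have [F F0 [f1_le _ _]] := rhs_estimates (equationP P) hf1 hf2.
have [W W0 hW] : exists2 W, 0 <= W & forall (ik : 'I_s * 'I_3) x,
    0 <= x <= c M ik.1 -> `|(stage_defect M ik.2 ik.1).[x]| <= W.
  apply: uniform_bound => ij; exact: horner_bounded.
have [U U0 hU] : exists2 U, 0 <= U & forall (i : 'I_s) x,
    0 <= x <= 1 -> `|(w i).[x]| <= U.
  apply: uniform_bound => ij; exact: horner_bounded.
exists (\sum_(k < 3) \sum_(i < s) U * (F * (W * m))).
  by apply: sumr_ge0 => k _; apply: sumr_ge0 => i _; rewrite !mulr_ge0.
move=> h alpha /andP[h0 h1] cb a01; have hge0 := ltW h0.
pose e k i := fun theta : R =>
  (stage_defect M k i).[Num.max (c M i * h + theta) 0 / h] *: gamma k.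
have Ce k i : in_C r (e k i).
  apply: (@in_C_max_shift _ _ _ (fun x => (stage_defect M k i).[x / h] *: gamma k)).
  exact: continuous_horner_div.
have ch0 i : 0 <= c M i * h by rewrite mulr_ge0 ?c_ge0.
have domS i : domain (equation P) (t_ h i, segment_at (sol P) (t_ h i)).
  have [] := @sol_segment _ P (t_ h i) => //; first by rewrite lerDl.
  by rewrite (le_lt_trans _ sbt)// lee_fin lerD2l.
have lin i : forall (a : R) psi chi, in_C r psi -> in_C r chi ->
    T_ h i (a *: psi + chi) = a *: T_ h i psi + T_ h i chi.
  by have [lin _ _ _] := hf1; exact: lin (domS i).
have xc i theta : history r theta ->
    0 <= Num.max (c M i * h + theta) 0 / h <= c M i.
  move=> Ht; rewrite divr_ge0 ?le_max ?lexx ?orbT//= ler_pdivrMr// ge_max.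
  by rewrite gerDl (history_le0 Ht) ch0.
have -> : \sum_i (w i).[alpha] *: T_ h i (leading_deviation M gamma h i)
    = \sum_(k < 3) (h ^+ (k + 2) / k`!%:R) *: \sum_i (w i).[alpha] *: T_ h i (e k i).
  rewrite [RHS](eq_bigr (fun k : 'I_3 => \sum_i (w i).[alpha] *:
      ((h ^+ (k + 2) / k`!%:R) *: T_ h i (e k i)))); last first.
    by move=> k _; rewrite scaler_sumr; apply: eq_bigr => i _; rewrite !scalerA mulrC.
  rewrite exchange_big; apply: eq_bigr => i _; rewrite -scaler_sumr; congr (_ *: _).
  rewrite /leading_deviation (linC_sum (lin i)); last first.
    by move=> k _; apply: in_CZ; exact: Ce.
  by apply: eq_bigr => k _; rewrite (linCZ (lin i) _ (Ce _ _)).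
rewrite (le_trans (vnorm_sum (problem_norm P) _ _ _))// mulr_suml ler_sum// => k _.
have gm : N (gamma k) <= m by apply: Gm; [case: k => -[|[|[|]]]|rewrite lexx lerDl ltW].
rewrite vnormZ// ger0_norm ?divr_ge0 ?exprn_ge0//.
have Q0 : 0 <= \sum_(i < s) U * (F * (W * m)).
  by apply: sumr_ge0 => i _; rewrite !mulr_ge0.
have [kn|nk] := ltnP k n.
  rewrite (sum_fibers_eq0 (c := c M)) ?vnorm0 ?mulr0 ?mulr_ge0 ?exprn_ge0// => x.
  have [i0 ci0|noi] := pickP (fun i => c M i == x); last by rewrite big_pred0.
  rewrite (eq_bigr (fun i => T_ h i0 ((w i).[alpha] *: e k i))); last first.
    move=> i /eqP ci; rewrite -(linCZ (lin i) _ (Ce _ _)).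
    by rewrite ci (eqP ci0).
  rewrite -(linC_sum (lin i0)); last by move=> i _; apply: in_CZ; exact: Ce.
  set g := \sum_(i | _) _.
  have Cg : in_C r g by apply: in_C_sum => i _; apply: in_CZ; exact: Ce.
  apply: (vnorm_eq0 (problem_norm P)).
  apply: le_trans (f1_le _ _ _ (domS i0) Cg) _.
  rewrite mulr_ge0_le0//; apply: maxnorm_le => // theta Ht.
  rewrite /g fct_sumE (eq_bigr (fun i => ((w i).[alpha] *
      (stage_defect M k i).[Num.max (x * h + theta) 0 / h]) *: gamma k)); last first.
    by move=> i /eqP ci; rewrite fctE /e ci scalerA.
  rewrite -scaler_suml hw ?scale0r ?vnorm0//.
  by have := xc i0 _ Ht; rewrite (eqP ci0).
rewrite mulrC ler_pM ?vnorm_ge0 ?divr_ge0 ?exprn_ge0//; last first.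
  rewrite ler_pdivrMr ?ltr0n ?fact_gt0// (@le_trans _ _ (h ^+ (n + 2)))//.
    by rewrite ler_wiXn2l// leq_add2r.
  by rewrite ler_peMr ?exprn_ge0// ler1n fact_gt0.
rewrite (le_trans (vnorm_sum (problem_norm P) _ _ _))// ler_sum// => i _.
rewrite vnormZ// ler_pM ?vnorm_ge0 ?hU//.
apply: le_trans (f1_le _ _ _ (domS i) (Ce _ _)) _.
rewrite ler_wpM2l//; apply: maxnorm_le => // theta Ht.
by rewrite /e vnormZ// ler_pM ?vnorm_ge0//; apply: (hW (i, k)); exact: xc.
Qed.

(** The degrees [6 - l] and [4 - l] are the least for which the [l] outer powers of
[h] bring the quadrature defect and the effect of the stage errors up to
[h ^+ 6]. *)
Lemma integrated_error (w : 'I_s -> {poly R}) (l : nat) (C0 : R) :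
  (0 < l <= 2)%N -> 0 <= C0 ->
  (forall k alpha, (k < 6 - l)%N -> 0 <= alpha <= 1 ->
     \sum_i (w i).[alpha] * c M i ^+ k = k`!%:R / (k + l)`!%:R * alpha ^+ (k + l)) ->
  (forall (x alpha beta : R) k, (k < 4 - l)%N -> 0 <= alpha <= 1 -> 0 <= beta <= x ->
     \sum_(i | c M i == x) (w i).[alpha] * (stage_defect M k i).[beta] = 0) ->
  exists2 C, 0 <= C & forall (h alpha : R) (K : 'I_s -> V), 0 < h <= 1 ->
    (forall i, c M i * h <= b) -> h <= b -> 0 <= alpha <= 1 ->
    (forall i, N (K i - G 2%N (t_ h i)
       - T_ h i (leading_deviation M gamma h i)) <= C0 * h ^+ 5) ->
    N (\sum_(i < l) ((alpha * h) ^+ i / i`!%:R) *: G (2 - l + i)%N sig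
       + h ^+ l *: (\sum_i (w i).[alpha] *: K i) - G (2 - l)%N (sig + alpha * h))
    <= C * h ^+ 6.
Proof.
move=> /andP[l0 l2] C00 quad hdef.
have l6 : (6 - l + l)%N = 6%N by rewrite subnK// (leq_trans l2).
have l4 : (4 - l <= 3)%N by move: l0 l2; clear; lia.
have [B B0 hB] := weighted_leading l4 hdef.
have [U U0 hU] : exists2 U, 0 <= U & forall (i : 'I_s) x,
    0 <= x <= 1 -> `|(w i).[x]| <= U.
  apply: uniform_bound => ij; exact: horner_bounded.
pose Q := (\sum_i U * c M i ^+ (6 - l) + 1) * m.
have S0 : 0 <= \sum_i U * c M i ^+ (6 - l).
  by apply: sumr_ge0 => i _; rewrite mulr_ge0 ?exprn_ge0 ?c_ge0.
have Q0 : 0 <= Q by rewrite mulr_ge0 ?addr_ge0.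
exists (Q + (\sum_(i < s) U * C0) + B).
  by rewrite !addr_ge0//; apply: sumr_ge0 => i _; rewrite mulr_ge0.
move=> h alpha K h01 cb hb a01 hK.
have [h0 h1] := andP h01; have hge0 := ltW h0.
have [a0 a1] := andP a01.
have c0 i : 0 <= c M i by exact: c_ge0.
have c01 j : 0 <= c M j * h <= b by rewrite cb mulr_ge0.
have ah : alpha * h <= b by rewrite (le_trans _ hb)// ler_piMl.
have n5 : (6 - l <= 5)%N by move: l0; clear; lia.
have hG' k : (k < (6 - l).+2)%N -> has_deriv_on `[sig, sig + b] (G k) (G k.+1).
  by move=> k5; apply: hG; rewrite (leq_trans k5)// !ltnS.
have Gm' k t : (k <= (6 - l).+2)%N -> sig <= t <= sig + b -> N (G k t) <= m.
  by move=> k5; apply: Gm; rewrite (leq_trans k5)// !ltnS.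
have := quadrature_defect (n := 6 - l) (l := l) (problem_norm P)
  (fun j => (w j).[alpha]) l2 m0 hG' Gm' hge0 c01 c0 a0 ah.
rewrite [X in N (_ - X)]big1 ?subr0 ?l6; last first.
  by move=> k _; rewrite quad// subrr mulr0 scale0r.
move=> qle.
have KE i : K i = G 2%N (t_ h i) + (K i - G 2%N (t_ h i)
    - T_ h i (leading_deviation M gamma h i))
    + T_ h i (leading_deviation M gamma h i).
  by rewrite -addrA subrK addrC subrK.
have -> : \sum_i (w i).[alpha] *: K i = \sum_i (w i).[alpha] *: G 2%N (t_ h i)
   + \sum_i (w i).[alpha] *: (K i - G 2%N (t_ h i)
       - T_ h i (leading_deviation M gamma h i))
   + \sum_i (w i).[alpha] *: T_ h i (leading_deviation M gamma h i).
  by rewrite -!big_split/=; apply: eq_bigr => i _; rewrite {1}KE !scalerDr.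
set q2 := \sum_i _ *: (_ - _); set q3 := \sum_i _ *: f1 _ _ _.
set q1 := (X in X + q2 + q3).
set q0 := (X in N (X + h ^+ l *: _ - _)); set q4 := G _ (_ + alpha * h).
have -> : q0 + h ^+ l *: (q1 + q2 + q3) - q4
    = (q0 + h ^+ l *: q1 - q4) + (h ^+ l *: q2 + h ^+ l *: q3).
  by clearbody q0 q1 q2 q3 q4; apply/rowP => j; rewrite !mxE; ring.
rewrite (le_trans (vnorm_triangle (problem_norm P) _ _))//.
rewrite -[X in _ <= X * _]addrA mulrDl lerD//.
  rewrite (le_trans qle)// ler_wpM2r ?exprn_ge0// ler_wpM2r// lerD ?exprn_ile1//.
  by apply: ler_sum => i _; rewrite ler_wpM2r ?exprn_ge0 ?hU.
rewrite (le_trans (vnorm_triangle (problem_norm P) _ _))// mulrDl lerD//.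
  rewrite vnormZ// ger0_norm ?exprn_ge0// exprS mulrCA ler_pM ?exprn_ge0 ?vnorm_ge0//.
    by rewrite -[leRHS]expr1 ler_wiXn2l.
  rewrite (le_trans (vnorm_sum (problem_norm P) _ _ _))// mulr_suml ler_sum// => i _.
  by rewrite vnormZ// -mulrA ler_pM ?vnorm_ge0 ?hU.
rewrite vnormZ// ger0_norm ?exprn_ge0//.
have -> : h ^+ 6 = h ^+ l * h ^+ (4 - l + 2).
  by rewrite -exprD; congr (h ^+ _); move: l0 l2; clear; lia.
by rewrite mulrCA ler_wpM2l ?exprn_ge0// hB.
Qed.

End Stages.

(** * Sufficiency of the order conditions *)

Section OrderConditions.
Variables (R : realType) (s : nat) (M : fcrkn R s).

Definition quadrature_conditions (w : 'I_s -> {poly R}) (l n : nat) : Prop :=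
  forall k alpha, (k < n)%N -> 0 <= alpha <= 1 ->
    \sum_i (w i).[alpha] * c M i ^+ k = k`!%:R / (k + l)`!%:R * alpha ^+ (k + l).

(** For [x] not among the abscissae the sum is empty; quantifying over all [x] saves
the enumeration of the abscissae. *)
Definition stage_conditions (w : 'I_s -> {poly R}) (n : nat) : Prop :=
  forall (x alpha beta : R) k, (k < n)%N -> 0 <= alpha <= 1 -> 0 <= beta <= x ->
    \sum_(i | c M i == x) (w i).[alpha] * (stage_defect M k i).[beta] = 0.

Lemma order_five_of_conditions :
  (forall (i : 'I_s) (alpha : R), 0 <= alpha <= c M i ->
     \sum_(j < s) (A M i j).[alpha] = alpha ^+ 2 / 2) ->
  quadrature_conditions (b' M) 1 5 -> stage_conditions (b' M) 3 ->
  quadrature_conditions (b M) 2 4 -> stage_conditions (b M) 2 ->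
  forall P : problem R, f_class_C2 P -> solution_piecewise_class_C 7 P ->
  order_on_problem M 5 P.
Proof.
move=> hA qb' sb' qb sb P [f1 [f2 [hf1 hf2]]] solC.
have [b0 [G [m [b0_gt0 m0 sbt [hG G012 Gm]]]]] := local_smoothness solC.
have [h0 [C0 [h0_gt0 C00 hK]]] :=
  stages_exist b0_gt0 m0 sbt hG G012 Gm hA hf1 hf2.
have [C1 C10 hC1] := integrated_error b0_gt0 m0 sbt hG Gm hf1 hf2
  (w := b' M) (l := 1) isT C00 qb' sb'.
have [C2 C20 hC2] := integrated_error b0_gt0 m0 sbt hG Gm hf1 hf2
  (w := b M) (l := 2) isT C00 qb sb.
pose q := 1 + \sum_i c M i.
have S0 : 0 <= \sum_i c M i by apply: sumr_ge0 => i _; exact: c_ge0.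
have q1 : 1 <= q by rewrite lerDl.
have q0 : 0 < q by rewrite (lt_le_trans ltr01).
have c_le i : c M i <= q.
  rewrite /q (bigD1 i)//= addrCA lerDl addr_ge0//.
  by apply: sumr_ge0 => j _; exact: c_ge0.
exists (Num.min (Num.min 1 h0) (b0 / q)), (C2 + 1), (C1 + 1).
rewrite !lt_min ltr01 h0_gt0 divr_gt0// !ltr_wpDl//; split => // h.
rewrite !lt_min ltr_pdivlMr// => /andP[hp /andP[/andP[h1 hh0] hb]].
have hb0 : h <= b0 by rewrite (le_trans _ (ltW hb))// ler_peMr// ltW.
have cb i : c M i * h <= b0.
  by rewrite (le_trans _ (ltW hb))// mulrC ler_wpM2l// ltW.
split; first by rewrite (le_lt_trans _ sbt)// lee_fin lerD2l.
have [|K sK KE] := hK h; first by rewrite hp.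
exists K => // alpha a01; have [a0 a1] := andP a01.
have h01 : 0 < h <= 1 by rewrite hp ltW.
have sx : sigma P <= sigma P + alpha * h <= sigma P + b0.
  by rewrite lerDl lerD2l mulr_ge0 ?(ltW hp)//= (le_trans _ hb0)// ler_piMl// ltW.
have s0 : sigma P <= sigma P <= sigma P + b0 by rewrite lexx lerDl ltW.
have [gx0 gx1 _] := G012 _ sx; have [gs0 gs1 _] := G012 _ s0.
have h6 : 0 <= h ^+ 6 by rewrite exprn_ge0// ltW.
split.
- have := hC2 h alpha K h01 cb hb0 a01 KE.
  rewrite !big_ord_recl big_ord0 /= subnn !add0n gx0 gs0 /bump/= addn0 gs1.
  rewrite sol_sigma dsol_sigma expr0 expr1 !divr1 scale1r addr0 => /le_trans; apply.
  by rewrite ler_wpM2r// lerDl.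
- have := hC1 h alpha K h01 cb hb0 a01 KE.
  rewrite big_ord_recl big_ord0 /= gx1 gs1.
  rewrite dsol_sigma expr0 expr1 !divr1 scale1r addr0 => /le_trans; apply.
  by rewrite ler_wpM2r// lerDl.
Qed.

End OrderConditions.

(** * Coefficients separating the abscissae *)

Section Separation.
Variable R : realType.

(** Absolute values make [pi], instead of its double, a period of the sine. *)
Lemma norm_sin_subpi (z : R) n : `|sin (z - n%:R * pi)| = `|sin z|.
Proof.
elim: n => [|n IH]; first by rewrite mul0r subr0.
rewrite -natr1 mulrDl mul1r opprD addrA -IH -[in RHS](subrK pi (z - _)).
by rewrite sinDpi normrN.
Qed.

(** A product of shifted sines, one for each point that has to be annihilated. *)
Lemma periodic_separation (x period : R) (ys : seq R) : 0 < period ->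
  (forall y, y \in ys -> y != x -> `|x - y| < period) ->
  exists W : R -> R, [/\ continuous W, forall u, `|W u| <= 1,
    forall u n, `|W (u - n%:R * period)| = `|W u|, W x != 0
    & forall y, y \in ys -> y != x -> W y = 0].
Proof.
move=> p0; elim: ys => [_|y ys IH hys].
  exists (fun=> 1); split => [|u|u n||//]; rewrite ?normr1 ?oner_neq0//.
  exact: cst_continuous.
have [|W [Wc W1 Wp Wx Wys]] := IH.
  by move=> z zs; apply: hys; rewrite inE zs orbT.
have [yx|yx] := eqVneq y x.
  exists W; split => // z; rewrite inE => /predU1P[->|]; last exact: Wys.
  by rewrite yx eqxx.
exists (fun u => W u * sin (pi * (u - y) / period)); split.
- move=> u; apply: cvgM; first exact: Wc.
  apply: continuous_comp; last exact: continuous_sin.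
  apply: cvgM; last exact: cvg_cst.
  by apply: cvgM; [exact: cvg_cst|apply: cvgB; [exact: cvg_id|exact: cvg_cst]].
- move=> u; rewrite normrM mulr_ile1// ler_norml.
  by rewrite sin_geN1 sin_le1.
- move=> u n; rewrite !normrM Wp; congr (_ * _).
  rewrite -[in RHS](norm_sin_subpi _ n); congr (`| sin _ |).
  by field; rewrite gt_eqF.
- rewrite mulf_neq0//.
  have : `|x - y| < period by apply: hys; rewrite ?mem_head.
  have pp : 0 < pi :> R by exact: pi_gt0.
  have [xy|yx'] := ltP y x.
    rewrite ger0_norm ?subr_ge0 ?ltW// => xp.
    rewrite gt_eqF// sin_gt0_pi// divr_gt0 ?mulr_gt0 ?subr_gt0//=.
    by rewrite ltr_pdivrMr// ltr_pM2l.
  rewrite ler0_norm ?subr_le0// opprB => xp.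
  have {}yx : x < y by rewrite lt_neqAle eq_sym yx.
  rewrite -oppr_eq0 -sinN gt_eqF// sin_gt0_pi// -mulNr -mulrN opprB.
  rewrite divr_gt0 ?mulr_gt0 ?subr_gt0//=.
  by rewrite ltr_pdivrMr// ltr_pM2l.
- move=> z; rewrite inE => /predU1P[-> _|zs zx]; last by rewrite Wys// mul0r.
  by rewrite subrr mulr0 mul0r sin0 mulr0.
Qed.

(** With a geometric sequence of stepsizes of ratio [q], the logarithms of
[y * q ^+ n] form an arithmetic progression, so that a function [W] of the
logarithm that is periodic up to sign does not see [n]: it suffices to separate
[ln x] from the other [ln y] modulo the period [- ln q], which is taken larger
than all their distances. The amplitude, a square root, restores continuity at
[0]. *)
Lemma separating_coefficient (x : R) (ys : seq R) : 0 < x ->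
  exists (a : R -> R) (w : R), [/\ continuous a, forall t, `|a t| <= 1, 0 < w &
    forall e, 0 < e -> exists h, [/\ 0 < h, h < e,
      forall y, y \in ys -> 0 <= y -> y != x -> a (y * h) = 0
      & w * Num.sqrt h <= `|a (x * h)|]].
Proof.
(* The abscissa [0] has no logarithm; there the amplitude vanishes. *)
move=> x0; pose ls := [seq ln y | y <- ys & 0 < y].
pose period := 1 + \sum_(z <- ls) `|ln x - z|.
have p0 : 0 < period by rewrite ltr_pwDl// sumr_ge0.
have [|W [Wc W1 Wp Wx Wys]] := @periodic_separation (ln x) period ls p0.
  move=> z zls _; rewrite /period (big_rem z)//= addrCA ltrDl.
  by rewrite ltr_pwDl// sumr_ge0.
pose amp (t : R) : R := Num.min 1 (Num.sqrt `|t|).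
have amp0 t : 0 <= amp t by rewrite le_min ler01 sqrtr_ge0.
have ampc : continuous amp.
  move=> t; apply: (@continuous_min _ _ (cst 1) (fun u => Num.sqrt `|u|)).
    exact: cvg_cst.
  apply: continuous_comp; first exact: norm_continuous.
  exact: sqrt_continuous.
exists (fun t => amp t * W (ln `|t|)), (Num.min 1 (Num.sqrt x) * `|W (ln x)|).
split.
- move=> t; have [->|t0] := eqVneq t 0.
    rewrite /continuous_at [amp 0](_ : _ = 0) ?mul0r; last first.
      by rewrite /amp normr0 sqrtr0 min_r// ler01.
    apply/norm_cvg0P.
    apply: (@squeeze_cvgr _ _ _ _ (cst 0) amp).
    + near=> u; rewrite normr_ge0/= normrM ger0_norm// ler_piMr//.
    + exact: cvg_cst.
    + have := ampc 0; rewrite /continuous_at [amp 0](_ : _ = 0)//.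
      by rewrite /amp normr0 sqrtr0 min_r// ler01.
  apply: cvgM; first exact: ampc.
  apply: continuous_comp; last exact: Wc.
  apply: continuous_comp; first exact: norm_continuous.
  by apply: continuous_ln; rewrite normr_gt0.
- move=> t; rewrite normrM mulr_ile1// ger0_norm//.
  by rewrite /amp ge_min lexx.
- by rewrite mulr_gt0 ?normr_gt0// lt_min ltr01 sqrtr_gt0.
move=> e e0; pose q := expR (- period).
have q0 : 0 < q by exact: expR_gt0.
have q1 : q < 1 by rewrite /q -[ltRHS]expR0 ltr_expR oppr_lt0.
have [n qn] : exists n, q ^+ n < e.
  have : (q ^+ n) @[n --> \oo] --> 0 by apply: cvg_expr; rewrite ger0_norm ?ltW.
  move=> /cvgrPdist_lt/(_ _ e0)[n _ /(_ n (leqnn _))].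
  by rewrite sub0r normrN ger0_norm ?exprn_ge0 ?ltW//; exists n.
have qn0 : 0 < q ^+ n by rewrite exprn_gt0.
have lnE y : 0 < y -> ln `|y * q ^+ n| = ln y - n%:R * period.
  move=> y0; rewrite gtr0_norm ?mulr_gt0// lnM ?posrE//.
  by rewrite lnXn// /q expRK mulNrn mulr_natl.
exists (q ^+ n); split => //.
- move=> y yys; rewrite le_eqVlt => /predU1P[<-|y0] yx.
    by rewrite mul0r /amp normr0 sqrtr0 min_r ?mul0r// ler01.
  rewrite lnE//; apply/eqP; rewrite mulf_eq0 -[X in _ || X]normr_eq0 Wp normr_eq0.
  rewrite Wys ?eqxx ?orbT//.
    by apply/mapP; exists y => //; rewrite mem_filter y0.
  by apply: contra yx => /eqP/ln_inj ->//; rewrite posrE.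
- rewrite lnE// normrM Wp (ger0_norm (amp0 _)) mulrAC ler_wpM2r//.
  rewrite /amp gtr0_norm ?mulr_gt0// sqrtrM ?(ltW x0)//.
  have sq : Num.sqrt (q ^+ n) <= 1.
    by rewrite -sqrtr1 ler_sqrt// exprn_ile1// ltW.
  rewrite le_min; apply/andP; split.
    by rewrite mulr_ile1 ?le_min ?ler01 ?sqrtr_ge0// ge_min lexx.
  by rewrite ler_wpM2r ?sqrtr_ge0// ge_min lexx orbT.
Unshelve. all: by end_near. Qed.

End Separation.

(** * Test problems with proportional delay *)

Lemma in_C_continuous (R : realType) (d : nat) (r : R) (f : R -> 'rV[R]_d) :
  continuous f -> in_C r%:E f.
Proof. by move=> cf; split => //; exact: continuous_subspaceT. Qed.

Section TestProblem.
Variables (R : realType) (k : nat) (a : R -> R) (lam : R).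
Hypotheses (a_cont : continuous a) (a_le1 : forall t, `|a t| <= 1)
  (lam01 : 0 <= lam <= 1).
Local Notation V := 'rV[R]_1.
Local Notation e1 := (const_mx 1 : V).

Definition unit_norm (x : V) : R := `|x 0 0|.

Lemma unit_norm_is_norm : is_norm unit_norm.
Proof.
split => [x|c x|x y]; rewrite /unit_norm.
- by move=> /normr0_eq0 x0; apply/matrixP => i j; rewrite !ord1 mxE.
- by rewrite mxE normrM.
- by rewrite mxE ler_normD.
Qed.

Definition test_poly : {poly R} := (k`!%:R / (k + 2)`!%:R) *: 'X^(k + 2).
(** The second derivative is the monomial of degree [k], by [test_poly_deriv2]. *)
Definition test_sol (t : R) : V := test_poly.[t] *: e1.
Definition test_dsol (t : R) : V := test_poly^`().[t] *: e1.

Lemma test_poly_deriv1 : test_poly^`() = (k`!%:R / (k + 1)`!%:R) *: 'X^(k + 1).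
Proof.
rewrite /test_poly derivZ derivXn addn2 addn1 /= -['X^_ *+ _]scaler_nat scalerA.
congr (_ *: _).
have : k.+2%:R != 0 :> R by rewrite pnatr_eq0.
have : k.+1`!%:R != 0 :> R by rewrite pnatr_eq0 -lt0n fact_gt0.
rewrite [k.+2`!]factS natrM; move: k.+2%:R k.+1`!%:R => u v u0 v0.
by field; rewrite u0.
Qed.

Lemma test_poly_deriv2 : test_poly^`()^`() = 'X^k.
Proof.
rewrite test_poly_deriv1 derivZ derivXn addn1 /= -['X^_ *+ _]scaler_nat scalerA.
rewrite [X in X *: _](_ : _ = 1) ?scale1r//.
have : k.+1%:R != 0 :> R by rewrite pnatr_eq0.
have : k`!%:R != 0 :> R by rewrite pnatr_eq0 -lt0n fact_gt0.
rewrite factS natrM; move: k.+1%:R k`!%:R => u v u0 v0.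
by field; rewrite u0.
Qed.

(** Near [t = 0] this is the proportional delay [t + test_delay t = lam * t] for
[t >= 0]; the cut-off keeps it in the history of length [1] at all times. *)
Definition test_delay (t : R) : R := Num.max (-1) (- ((1 - lam) * `|t|)).

Lemma test_delay_history t : history 1%:E (test_delay t).
Proof.
rewrite /history/= lee_fin le_max lexx/=; split => //.
rewrite ge_max lerN10 oppr_le0 mulr_ge0// subr_ge0.
by case/andP: lam01.
Qed.

Lemma test_delay_continuous : continuous test_delay.
Proof.
move=> t; apply: (@continuous_max _ _ (cst (-1)) (fun u => - ((1 - lam) * `|u|))).
  exact: cvg_cst.
apply: cvgN; apply: cvgM; first exact: cvg_cst.
exact: norm_continuous.
Qed.

(** The term in [a] vanishes along [test_sol]: it affects the method without
affecting the solution. *)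
Definition test_rhs (t : R) (f : R -> V) : V :=
  a t *: (f (test_delay t) - test_sol (t + test_delay t)) + t ^+ k *: e1.

Definition test_rfde : rfde R 1 :=
  Rfde unit_norm 1%:E [set tf | in_C 1%:E tf.2] test_rhs.

Definition test_rhs1 (t : R) (_ psi : R -> V) : V := a t *: psi (test_delay t).

Lemma test_sol_continuous : continuous test_sol.
Proof. by move=> t; apply: cvgZr_tmp; exact: continuous_horner. Qed.

Let r1 : (0 <= 1%:E :> \bar R)%E. Proof. by rewrite lee_fin. Qed.

Lemma test_rhs_incr t f psi :
  test_rhs t (f + psi) - test_rhs t f - test_rhs1 t f psi = 0.
Proof.
rewrite /test_rhs /test_rhs1; apply/rowP => j; rewrite !fctE !mxE; ring.
Qed.

Lemma test_deriv1 : is_rhs_deriv1 test_rfde test_rhs1.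
Proof.
have N0 := vnorm0 unit_norm_is_norm.
split.
- move=> t f _ c psi chi _ _; rewrite /test_rhs1 !fctE scalerDr !scalerA.
  by rewrite mulrC.
- exists 1 => t f _ psi Cpsi; rewrite /= (vnormZ unit_norm_is_norm).
  rewrite ler_pM ?(vnorm_ge0 unit_norm_is_norm)//.
  apply: (le_maxnorm r1 unit_norm_is_norm Cpsi); exact: test_delay_history.
- move=> t f _ e e0; exists 1; first exact: ltr01.
  move=> psi _ Cpsi _; rewrite /= test_rhs_incr N0.
  exact: mulr_ge0 (ltW e0) (maxnorm_ge0 r1 unit_norm_is_norm Cpsi).
- move=> t f _ e e0; exists 1; first exact: ltr01.
  move=> f' _ _ psi Cpsi; rewrite /= subrr N0.
  exact: mulr_ge0 (ltW e0) (maxnorm_ge0 r1 unit_norm_is_norm Cpsi).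
Qed.

Lemma test_deriv2 : is_rhs_deriv2 test_rfde test_rhs1 (fun _ _ _ _ => 0).
Proof.
have N0 := vnorm0 unit_norm_is_norm.
have ge0 psi : in_C 1%:E psi -> 0 <= norm_C test_rfde psi.
  exact: (maxnorm_ge0 r1 unit_norm_is_norm).
split.
- by move=> *; rewrite scaler0 addr0.
- by exists 0 => *; rewrite /= N0 !mul0r.
- move=> t f _ e e0; exists 1; first exact: ltr01.
  move=> psi _ Cpsi _ chi Cchi; rewrite /= /test_rhs1 subrr subr0 N0.
  exact: mulr_ge0 (mulr_ge0 (ltW e0) (ge0 _ Cpsi)) (ge0 _ Cchi).
- move=> t f _ e e0; exists 1; first exact: ltr01.
  move=> f' _ _ psi chi Cpsi Cchi; rewrite /= subrr N0.
  exact: mulr_ge0 (mulr_ge0 (ltW e0) (ge0 _ Cpsi)) (ge0 _ Cchi).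
Qed.

Lemma test_rhs_continuous : rhs_continuous test_rfde.
Proof.
move=> t f /= Cf e e0.
have Ft : test_rhs u f @[u --> t] --> test_rhs t f.
  apply: cvgD; last first.
    by apply: cvgZr_tmp; exact: (@exprn_continuous _ k).
  apply: cvgZ; first exact: a_cont.
  apply: cvgB.
    have [/subspace_continuousP cf _] := Cf.
    have h := cf _ (test_delay_history t).
    move=> W /h hW; have := test_delay_continuous hW.
    by apply: (@filterS _ (nbhs t)) => u /= Wu; apply: Wu; exact: test_delay_history.
  apply: continuous_comp; last exact: test_sol_continuous.
  by apply: cvgD; [exact: cvg_id|exact: test_delay_continuous].
have e2 : 0 < e / 2 by rewrite divr_gt0.
have near_t : nbhs t (fun u => unit_norm (test_rhs u f - test_rhs t f) < e / 2).
  exact: (cvg_vnorm unit_norm_is_norm _ Ft e2).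
have /nbhs_ballP[al /= al0 hal] := near_t.
exists (Num.min al (e / 2)); first by rewrite lt_min al0.
move=> u g Cg; rewrite !lt_min => /andP[ua _] /andP[_ ge].
rewrite (_ : _ - _ = a u *: (g (test_delay u) - f (test_delay u))
   + (test_rhs u f - test_rhs t f)); last first.
  rewrite addrA; congr (_ - _); rewrite /test_rhs addrA -scalerDr.
  by rewrite addrA subrK.
rewrite (le_lt_trans (vnorm_triangle unit_norm_is_norm _ _))// [e]splitr.
rewrite ltr_leD//; last first.
  by apply/ltW/hal; rewrite /ball/= distrC.
rewrite (vnormZ unit_norm_is_norm).
rewrite (le_lt_trans _ ge)// -[leRHS]mul1r ler_pM ?(vnorm_ge0 unit_norm_is_norm)//.
exact: (le_maxnorm r1 unit_norm_is_norm (in_CB Cg Cf) (test_delay_history u)).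
Qed.

Lemma test_is_rfde : is_rfde test_rfde.
Proof.
split; first exact: unit_norm_is_norm.
split; first exact: r1.
split; first by [].
split; first by move=> t f _; exists 1.
split; first exact: test_rhs_continuous.
by exists test_rhs1; exact: test_deriv1.
Qed.

Lemma in_C_shift_horner (p : {poly R}) t :
  in_C 1%:E (segment_at (fun u => p.[u] *: e1) t).
Proof.
apply: in_C_continuous => x; apply: cvgZr_tmp.
apply: continuous_comp; last exact: continuous_horner.
by apply: cvgD; [exact: cvg_cst|exact: cvg_id].
Qed.

Lemma test_segment_in_C1 t :
  in_C1 1%:E (segment_at test_sol t) (segment_at test_dsol t).
Proof.
split; [exact: in_C_shift_horner|exact: in_C_shift_horner|].
have -> : segment_at test_sol t = fun u => (test_poly \Po ('X + t%:P)).[u] *: e1.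
  by apply/funext => u; rewrite /segment_at /test_sol horner_comp !hornerE addrC.
have -> : segment_at test_dsol t = fun u => (test_poly \Po ('X + t%:P))^`().[u] *: e1.
  apply/funext => u; rewrite /segment_at /test_dsol deriv_comp derivD derivX derivC.
  by rewrite addr0 mulr1 horner_comp !hornerE addrC.
exact: has_deriv_on_horner.
Qed.

Lemma test_is_solution :
  is_solution test_rfde 0 test_sol test_dsol +oo%E test_sol test_dsol.
Proof.
split.
- by rewrite ltry.
- by split => // theta _; rewrite /segment_at add0r.
- exact: has_deriv_on_horner.
- move=> t _; have C1t := test_segment_in_C1 t; split; last exact: C1t.
  by case: C1t => Ct _ _; exact: Ct.
- have -> : (fun t => rhs test_rfde t (segment_at test_sol t))
      = fun t => test_poly^`()^`().[t] *: e1.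
    apply/funext => t; rewrite /= /test_rhs /segment_at subrr scaler0 add0r.
    by rewrite test_poly_deriv2 hornerXn.
  exact: has_deriv_on_horner.
Qed.

Lemma test_segment0 (f : R -> V) : segment_at f 0 = f.
Proof. by apply/funext => t; rewrite /segment_at add0r. Qed.

Lemma test_phi_C1 : in_C1 (delay test_rfde) test_sol test_dsol.
Proof. by have := test_segment_in_C1 0; rewrite !test_segment0. Qed.

Lemma test_initial : domain test_rfde (0, test_sol).
Proof. by case: test_phi_C1 => Cphi _ _; exact: Cphi. Qed.

Lemma test_maximal :
  non_continuable test_rfde 0 test_sol test_dsol +oo%E test_sol.
Proof. by move=> t u du _ _; rewrite leey. Qed.

Definition test_problem : problem R :=
  Problem test_is_rfde test_phi_C1 test_initial test_is_solution test_maximal.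

Lemma test_class_C2 : f_class_C2 test_problem.
Proof.
exists test_rhs1, (fun _ _ _ _ => 0).
by split; [exact: test_deriv1|exact: test_deriv2].
Qed.

Lemma test_solution_smooth n : solution_piecewise_class_C n test_problem.
Proof.
exists set0; split => [u v _|u v _ _ _]; first by rewrite set0I.
exists (fun j t => test_poly^`(j).[t] *: e1); split => //.
- by move=> j _; rewrite derivnS; exact: has_deriv_on_horner.
- apply: continuous_subspaceT => t; apply: cvgZr_tmp; exact: continuous_horner.
Qed.

End TestProblem.

(** * Local errors on the test problems *)

Section TestErrors.
Variables (R : realType) (s : nat) (M : fcrkn R s).
Variables (k : nat) (a : R -> R) (lam : R).
Hypotheses (a_cont : continuous a) (a_le1 : forall t, `|a t| <= 1)
  (lam01 : 0 <= lam <= 1).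
Let TP := test_problem k a_cont a_le1 lam01.
Local Notation excess h K := (fun i => K i 0 0 - (c M i * h) ^+ k : R).

Lemma test_poly0 : (test_poly R k).[0] = 0.
Proof. by rewrite /test_poly hornerZ hornerXn addnS expr0n mulr0. Qed.

Lemma test_sol0 : test_sol k 0 = 0 :> 'rV[R]_1.
Proof. by rewrite /test_sol test_poly0 scale0r. Qed.

Lemma test_dsol0 : test_dsol k 0 = 0 :> 'rV[R]_1.
Proof.
by rewrite /test_dsol test_poly_deriv1 hornerZ hornerXn addnS expr0n mulr0 scale0r.
Qed.

Lemma lam_c_itv i : 0 <= lam * c M i <= c M i.
Proof.
have ci := c_ge0 M i; case/andP: lam01 => l0 l1.
by rewrite mulr_ge0//= ler_piMl.
Qed.

(** Both branches of the definition of a stage function give the same value here: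
the argument is nonnegative, and at [0] everything vanishes. *)
Lemma test_stage_function h (K : 'I_s -> 'rV[R]_1) i : 0 < h ->
  stage_function (P := TP) M h K i (lam * c M i * h) 0 0
  = h ^+ 2 * \sum_j (A M i j).[lam * c M i] * K j 0 0.
Proof.
move=> h0; rewrite /stage_function mulfK ?gt_eqF//=; case: ifPn => x0.
  have lc0 : lam * c M i = 0.
    apply: le_anti; rewrite -(pmulr_lle0 _ h0) x0.
    by case/andP: (lam_c_itv i) => ->.
  rewrite lc0 mul0r test_sol0 mxE big1 ?mulr0// => j _.
  by rewrite A_at0 mul0r.
rewrite test_sol0 test_dsol0 scaler0 !add0r mxE summxE; congr (_ * _).
rewrite big_mkcond/=; apply: eq_bigr => j _; case: ifPn => [_|]; first by rewrite mxE.
by rewrite -leqNgt => ij; rewrite A_strict_lower// horner0 mul0r.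
Qed.

(** The equation being affine in the state, the errors of the stage values satisfy
this exact triangular recursion, whose source term is a stage defect. *)
Lemma test_excess h (K : 'I_s -> 'rV[R]_1) : 0 < h ->
  (forall i, c M i * h <= 1) -> stage_values (P := TP) M h K ->
  forall i, excess h K i = a (c M i * h) *
    (h ^+ (k + 2) * (stage_defect M k i).[lam * c M i]
     + h ^+ 2 * \sum_j (A M i j).[lam * c M i] * excess h K j).
Proof.
move=> h0 ch hK i; have [_ KE] := hK i.
have ch0 : 0 <= c M i * h by rewrite mulr_ge0 ?c_ge0 ?ltW.
have [l0 l1] := andP lam01.
rewrite [in LHS]KE /= /test_rhs add0r /segment_at.
have -> : c M i * h + test_delay lam (c M i * h) = lam * c M i * h.
  rewrite /test_delay ger0_norm// max_r; first by ring.
  by rewrite lerN2 mulr_ile1// ?subr_ge0// gerBl.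
rewrite !mxE test_stage_function// /test_poly hornerZ hornerXn !mulr1.
rewrite addrK; congr (_ * _); rewrite horner_stage_defect.
under [in RHS]eq_bigr do rewrite mulrBr.
rewrite [in RHS]sumrB.
have -> : \sum_(i0 < s) (A M i i0).[lam * c M i] * (c M i0 * h) ^+ k
    = h ^+ k * \sum_j (A M i j).[lam * c M i] * c M j ^+ k.
  by rewrite mulr_sumr; apply: eq_bigr => j _; rewrite exprMn; ring.
by rewrite !exprMn !exprD; ring.
Qed.

(** In the recursion the preceding stage errors are multiplied by [h ^+ 2], hence
contribute two orders more than the source term. *)
Lemma test_excess_bounds : exists2 C, 0 <= C &
  forall h (K : 'I_s -> 'rV[R]_1), 0 < h <= 1 ->
  (forall i, c M i * h <= 1) -> stage_values (P := TP) M h K ->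
  forall i, `|excess h K i - a (c M i * h) *
              (h ^+ (k + 2) * (stage_defect M k i).[lam * c M i])|
            <= C * h ^+ (k + 4).
Proof.
have [W W0 hW] : exists2 W, 0 <= W & forall (ij : 'I_s * 'I_s) x,
    0 <= x <= c M ij.1 -> `|(A M ij.1 ij.2).[x]| <= W.
  apply: uniform_bound => ij; exact: horner_bounded.
have [U U0 hU] : exists2 U, 0 <= U & forall (i : 'I_s) x,
    0 <= x <= c M i -> `|(stage_defect M k i).[x]| <= U.
  apply: uniform_bound => i; exact: horner_bounded.
have step C h (K : 'I_s -> 'rV[R]_1) (i : 'I_s) : 0 <= C -> 0 < h ->
    (forall j : 'I_s, (j < i)%N -> `|excess h K j| <= C * h ^+ (k + 2)) ->
    `|h ^+ 2 * \sum_j (A M i j).[lam * c M i] * excess h K j|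
    <= (\sum_(j < s) W * C) * h ^+ (k + 4).
  move=> C0 h0 hj; have hge0 := ltW h0.
  rewrite normrM ger0_norm ?exprn_ge0// -[4%N]/(2 + 2)%N addnA [h ^+ (_ + 2)]exprD.
  rewrite [h ^+ (k + 2) * _]mulrC mulrCA ler_wpM2l ?exprn_ge0//.
  rewrite (le_trans (ler_norm_sum _ _ _))// mulr_suml ler_sum// => j _.
  rewrite normrM; have [ji|ij] := ltnP j i; last first.
    by rewrite A_strict_lower// horner0 normr0 mul0r !mulr_ge0 ?exprn_ge0.
  rewrite -mulrA ler_pM ?hj//; apply: (hW (i, j)); exact: lam_c_itv.
have [C C0 hC] : exists2 C, 0 <= C &
    forall h (K : 'I_s -> 'rV[R]_1), 0 < h <= 1 ->
    (forall i, c M i * h <= 1) -> stage_values (P := TP) M h K ->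
    forall i : 'I_s, `|excess h K i| <= C * h ^+ (k + 2).
  suff /(_ s)[C C0 hC] : forall n, exists2 C, 0 <= C &
      forall h (K : 'I_s -> 'rV[R]_1), 0 < h <= 1 ->
      (forall i, c M i * h <= 1) -> stage_values (P := TP) M h K ->
      forall i : 'I_s, (i < n)%N -> `|excess h K i| <= C * h ^+ (k + 2).
    by exists C => // h K h01 ch hK i; apply: hC.
  elim=> [|n [C C0 IH]]; first by exists 0.
  exists (U + \sum_(j < s) W * C).
    by rewrite addr_ge0// sumr_ge0// => j _; rewrite mulr_ge0.
  move=> h K h01 ch hK i ni; have [h0 h1] := andP h01; have hge0 := ltW h0.
  rewrite test_excess// normrM (le_trans (ler_piMl _ (a_le1 _)))//.
  rewrite mulrDl (le_trans (ler_normD _ _))// lerD//.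
    rewrite normrM ger0_norm ?exprn_ge0// mulrC ler_wpM2r ?exprn_ge0// hU//.
    exact: lam_c_itv.
  apply: (le_trans (step C h K i C0 h0 _)).
    by move=> j ji; apply: IH => //; exact: leq_trans ji _.
  rewrite ler_wpM2l ?ler_wiXn2l ?leq_add2l//.
  by apply: sumr_ge0 => j _; rewrite mulr_ge0.
exists (\sum_(j < s) W * C); first by apply: sumr_ge0 => j _; rewrite mulr_ge0.
move=> h K h01 ch hK i; have [h0 h1] := andP h01.
rewrite test_excess// -mulrBr addrAC subrr add0r normrM.
rewrite (le_trans (ler_piMl _ (a_le1 _)))//.
by apply: step => // j _; exact: hC.
Qed.

Definition error_weights (l : nat) : 'I_s -> {poly R} :=
  if l == 1%N then b' M else b M.

(** The error at [alpha * h] is the [l]-fold integral of the stage values against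
the weights, minus the value of an explicit monomial; each stage value is
replaced by the monomial of degree [k] plus its error. *)
Lemma test_error_expansion p l alpha : (0 < l <= 2)%N -> 0 <= alpha <= 1 ->
  order_on_problem M p TP ->
  exists h0 C : R, [/\ 0 < h0, h0 <= 1, 0 <= C & forall h, 0 < h < h0 ->
    let w := error_weights l in
    `|h ^+ (k + l) * (\sum_i (w i).[alpha] * c M i ^+ k
         - k`!%:R / (k + l)`!%:R * alpha ^+ (k + l))
      + h ^+ (k + 2 + l) * \sum_i (w i).[alpha] *
          (a (c M i * h) * (stage_defect M k i).[lam * c M i])|
    <= C * (h ^+ p.+1 + h ^+ (k + 4 + l))].
Proof.
move=> l12 a01 [h0 [C1 [C2 [h0_gt0 C10 C20 hP]]]].
have [C3 C30 hC3] := test_excess_bounds.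
pose q := 1 + \sum_i c M i.
have q0 : 0 < q by rewrite ltr_pwDl// sumr_ge0// => i _; exact: c_ge0.
have c_le i : c M i <= q.
  rewrite /q (bigD1 i)//= addrCA lerDl addr_ge0// sumr_ge0// => j _; exact: c_ge0.
pose w := error_weights l.
pose B := \sum_i `|(w i).[alpha]| * C3.
have B0 : 0 <= B by apply: sumr_ge0 => i _; rewrite mulr_ge0.
exists (Num.min (Num.min 1 h0) q^-1), (C1 + C2 + B).
rewrite !lt_min ltr01 h0_gt0 invr_gt0 q0 !ge_min lexx !addr_ge0// ?(ltW C10) ?(ltW C20)//.
split => // h; rewrite !lt_min => /andP[hp /andP[/andP[h1 hh0] hq]].
have hge0 := ltW hp.
have ch i : c M i * h <= 1.
  have hq1 : q * h <= 1 by rewrite -(mulfV (lt0r_neq0 q0)) ler_pM2l// ltW.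
  by rewrite (le_trans _ hq1)// ler_wpM2r.
have [|_ [K sK hK]] := hP h; first by rewrite hp.
have [err2 err1] := hK _ a01.
pose err := h ^+ l * \sum_i (w i).[alpha] * K i 0 0
  - k`!%:R / (k + l)`!%:R * (alpha * h) ^+ (k + l).
have err_le : `|err| <= (C1 + C2) * h ^+ p.+1.
  rewrite mulrDl /err /w /error_weights.
  have hp0 : 0 <= h ^+ p.+1 by rewrite exprn_ge0.
  case: l l12 {w B B0 err} => [//|[_|[_|//]]] /=.
  - rewrite ler_wpDl ?mulr_ge0 ?(ltW C10)//.
    have <- : (local_error' M (P := TP) h K alpha) 0 0
      = h ^+ 1 * \sum_i (b' M i).[alpha] * K i 0 0
        - k`!%:R / (k + 1)`!%:R * (alpha * h) ^+ (k + 1).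
      rewrite /local_error' /eta' /= add0r test_dsol0 add0r /test_dsol.
      rewrite test_poly_deriv1 hornerZ hornerXn !mxE summxE mulr1 expr1.
      by congr (_ * _ - _); apply: eq_bigr => i _; rewrite mxE.
    exact: err1.
  - rewrite ler_wpDr ?mulr_ge0 ?(ltW C20)//.
    have <- : (local_error M (P := TP) h K alpha) 0 0
      = h ^+ 2 * \sum_i (b M i).[alpha] * K i 0 0
        - k`!%:R / (k + 2)`!%:R * (alpha * h) ^+ (k + 2).
      rewrite /local_error /eta /= add0r test_dsol0 test_sol0 scaler0 !add0r.
      rewrite /test_sol /test_poly hornerZ hornerXn !mxE summxE mulr1.
      by congr (_ * _ - _); apply: eq_bigr => i _; rewrite mxE.
    exact: err2.
rewrite /= -/w.
set X := (X in `|X| <= _).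
have -> : X = err - h ^+ l * \sum_i (w i).[alpha] * (K i 0 0 - (c M i * h) ^+ k
    - a (c M i * h) * (h ^+ (k + 2) * (stage_defect M k i).[lam * c M i])).
  rewrite /X /err.
  have -> : \sum_i (w i).[alpha] * (K i 0 0 - (c M i * h) ^+ k
      - a (c M i * h) * (h ^+ (k + 2) * (stage_defect M k i).[lam * c M i]))
    = \sum_i (w i).[alpha] * K i 0 0 - h ^+ k * (\sum_i (w i).[alpha] * c M i ^+ k)
      - h ^+ (k + 2) * \sum_i (w i).[alpha] *
          (a (c M i * h) * (stage_defect M k i).[lam * c M i]).
    rewrite !mulr_sumr -!sumrB; apply: eq_bigr => i _.
    by rewrite exprMn; ring.
  by rewrite !exprMn !exprD; ring.
rewrite (le_trans (ler_normB _ _))// mulrDr lerD//.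
  by rewrite (le_trans err_le)// ler_wpM2r ?exprn_ge0// lerDl.
rewrite normrM ger0_norm ?exprn_ge0// [h ^+ (_ + l)]exprD [_ * h ^+ l]mulrC mulrCA.
rewrite ler_wpM2l ?exprn_ge0//.
apply: (@le_trans _ _ (B * h ^+ (k + 4))); last first.
  by rewrite ler_wpM2r ?exprn_ge0// lerDr addr_ge0 ?ltW.
rewrite (le_trans (ler_norm_sum _ _ _))// mulr_suml ler_sum// => i _.
by rewrite normrM -mulrA ler_wpM2l// hC3// hp ltW.
Qed.

End TestErrors.

(** * Necessity of the order conditions *)

(** A bound by [h] beats a quantity of the size of the square root of [h]. *)
Lemma eq0_of_sqrt_bound (R : realType) (X w C : R) : 0 < w -> 0 <= C ->
  (forall e, 0 < e -> exists h, [/\ 0 < h, h < e & `|X| * (w * Num.sqrt h) <= C * h]) ->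
  X = 0.
Proof.
move=> w0 C0 hX; apply/eqP; apply: contraT => X0.
have C1 : 0 < C + 1 by rewrite ltr_wpDl.
have X_gt0 : 0 < `|X| * w by rewrite mulr_gt0// normr_gt0.
have d0 : 0 < `|X| * w / (C + 1) by rewrite divr_gt0.
have [h [h0 hd hC]] := hX _ (exprn_gt0 2 d0).
have sh : 0 < Num.sqrt h by rewrite sqrtr_gt0.
have : Num.sqrt h < `|X| * w / (C + 1).
  by rewrite -[ltRHS]ger0_norm ?ltW// -sqrtr_sqr ltr_sqrt// exprn_gt0.
rewrite ltr_pdivlMr// ltNge => /negP[].
move: hC; rewrite mulrA -[in X in _ <= _ * X](sqr_sqrtr (ltW h0)) expr2 mulrA.
rewrite ler_pM2r// => /le_trans; apply.
by rewrite mulrC ler_pM2l// lerDl.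
Qed.

Section Necessity.
Variables (R : realType) (s : nat) (M : fcrkn R s) (S : problem R -> Prop) (p : nat).
Hypothesis ordM : uniform_order S M p.
Hypothesis S_test : forall k (a : R -> R) lam (ac : continuous a)
  (a1 : forall t, `|a t| <= 1) (lam01 : 0 <= lam <= 1),
  S (test_problem k ac a1 lam01).

Lemma order_on_test_problem k (a : R -> R) lam (ac : continuous a)
    (a1 : forall t, `|a t| <= 1) (lam01 : 0 <= lam <= 1) :
  order_on_problem M p (test_problem k ac a1 lam01).
Proof.
case: ordM => n; apply; first exact: S_test.
exact: test_solution_smooth.
Qed.

(** With [a = 0] the test equation is a pure quadrature problem, whose error at
[h ^+ (k + l)] has to vanish as soon as [k + l <= p]. *)
Lemma quadrature_necessary l : (0 < l <= 2)%N ->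
  quadrature_conditions M (error_weights M l) l (p.+1 - l).
Proof.
move=> l12 k alpha kp a01; apply/eqP; rewrite -subr_eq0; apply/eqP.
have klp : (k + l <= p)%N by move: kp l12; clear; lia.
have a0c : continuous (fun _ : R => 0 : R) by exact: cst_continuous.
have a0le t : `|(fun _ : R => 0 : R) t| <= 1 by rewrite normr0.
have lam01 : 0 <= (0 : R) <= 1 by rewrite lexx ler01.
have [h0 [C [h0_gt0 h01 C0 hC]]] :=
  test_error_expansion l12 a01 (order_on_test_problem k a0c a0le lam01).
apply: (@eq0_of_sqrt_bound _ _ 1 (C + C)) => //; first by rewrite addr_ge0.
move=> e e0; pose h := Num.min h0 e / 2.
have h_gt0 : 0 < h by rewrite divr_gt0// lt_min h0_gt0.
have hh0 : h < h0 by rewrite ltr_pdivrMr// gt_min ltr_pMr// ltr1n.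
have he : h < e by rewrite ltr_pdivrMr// gt_min orbC ltr_pMr// ltr1n.
have h1 : h <= 1 by rewrite (le_trans (ltW hh0)).
have hge0 := ltW h_gt0.
exists h; split => //; rewrite mul1r.
set X := _ - _; have := hC h; rewrite h_gt0 hh0 => /(_ isT) /=; rewrite -/X.
rewrite [X in _ + h ^+ (k + 2 + l) * X]big1 ?mulr0 ?addr0; last first.
  by move=> i _; rewrite mul0r mulr0.
rewrite normrM ger0_norm ?exprn_ge0// => hX.
have : h ^+ (k + l) * `|X| <= h ^+ (k + l) * ((C + C) * h).
  rewrite (le_trans hX)// mulrCA -exprSr mulrDl mulrDr.
  by rewrite lerD// ler_wpM2l// ler_wiXn2l//; move: klp; clear; lia.
rewrite ler_pM2l ?exprn_gt0//; apply: le_trans.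
by rewrite ler_piMr// -sqrtr1 ler_sqrt.
Qed.

(** The proportion [lam = beta / x] makes the stages with abscissa [x] read their
stage functions at [beta * h]. The quadrature part of the error is already known
to vanish; unless the sum over these stages vanishes as well, what remains is at
least of size [h ^+ (k + l + 2)] times the square root of [h], which exceeds the
admissible [h ^+ p.+1]. *)
Lemma stage_necessary l : (0 < l <= 2)%N ->
  stage_conditions M (error_weights M l) (p.-1 - l).
Proof.
move=> l12 x alpha beta k kp a01 /andP[be0 bex].
have klp : (k + l + 2 <= p)%N by move: kp l12; clear; lia.
have x_ge0 : 0 <= x by exact: le_trans bex.
move: (x_ge0); rewrite le_eqVlt => /predU1P[x0|x0].
  have -> : beta = 0 by apply: le_anti; rewrite be0 x0 bex.
  by rewrite big1// => i _; rewrite stage_defect0 mulr0.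
have [a [w [ac a1 w0 hw]]] := separating_coefficient (codom (c M)) x0.
have lam01 : 0 <= beta / x <= 1.
  by rewrite divr_ge0//= ler_pdivrMr// mul1r.
have [h0 [C [h0_gt0 h01 C0 hC]]] :=
  test_error_expansion l12 a01 (order_on_test_problem k ac a1 lam01).
apply: (@eq0_of_sqrt_bound _ _ w (C + C)) => //; first by rewrite addr_ge0.
move=> e e0; have m0 : 0 < Num.min h0 e by rewrite lt_min h0_gt0.
have [h [h_gt0 + a0 aw]] := hw _ m0.
rewrite lt_min => /andP[hh0 he]; exists h; split => //.
have h1 : h <= 1 by rewrite (le_trans (ltW hh0)).
have hge0 := ltW h_gt0.
have := hC h; rewrite h_gt0 hh0 => /(_ isT) /=.
have kq : (k < p.+1 - l)%N by move: kp l12; clear; lia.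
rewrite (quadrature_necessary l12 kq a01) subrr mulr0 add0r.
set Y := \sum_(i < s) _.
have -> : Y = a (x * h) * \sum_(i < s | c M i == x)
    (error_weights M l i).[alpha] * (stage_defect M k i).[beta].
  rewrite /Y mulr_sumr [RHS]big_mkcond/=; apply: eq_bigr => i _.
  case: eqVneq => [->|cx]; first by rewrite divfK ?gt_eqF//; ring.
  by rewrite a0 ?c_ge0 ?codom_f// mul0r mulr0.
rewrite normrM ger0_norm ?exprn_ge0// => hX.
set X := \sum_(i | _) _ in hX *.
have : h ^+ (k + 2 + l) * `|a (x * h) * X| <= h ^+ (k + 2 + l) * ((C + C) * h).
  rewrite (le_trans hX)// mulrCA -exprSr mulrDl mulrDr.
  by rewrite lerD// ler_wpM2l// ler_wiXn2l//; move: klp; clear; lia.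
rewrite ler_pM2l ?exprn_gt0//; apply: le_trans.
by rewrite normrM mulrC ler_wpM2r.
Qed.

End Necessity.

(** * Conditions for order five *)

Theorem theorem5 (R : realType) (s : nat) (M : fcrkn R s) (cstar : seq R)
    (cstar_sorted : sorted <%R cstar)
    (cstar_values : forall x : R, (x \in cstar) = [exists i, c M i == x])
    (hb' : forall alpha : R, 0 <= alpha <= 1 ->
      \sum_(i < s) (b' M i).[alpha] = alpha)
    (hb : forall alpha : R, 0 <= alpha <= 1 ->
      \sum_(i < s) (b M i).[alpha] = alpha ^+ 2 / 2)
    (hA : forall (i : 'I_s) (alpha : R), 0 <= alpha <= c M i ->
      \sum_(j < s) (A M i j).[alpha] = alpha ^+ 2 / 2) :
  let S := fun P : problem R =>
    f_class_C2 P /\ solution_piecewise_class_C 6 P in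
  uniform_order S M 4 ->
  (uniform_order S M 5 <->
   [/\ forall alpha : R, 0 <= alpha <= 1 ->
         \sum_(i < s) (b' M i).[alpha] * c M i ^+ 4 = alpha ^+ 5 / 5,
       forall (alpha beta : R) (m : nat), (m < size cstar)%N ->
         0 <= alpha <= 1 -> 0 <= beta <= cstar`_m ->
         \sum_(i < s | c M i == cstar`_m) (b' M i).[alpha] *
           (\sum_(j < s) (A M i j).[beta] * c M j ^+ 2 - beta ^+ 4 / 12) = 0,
       forall alpha : R, 0 <= alpha <= 1 ->
         \sum_(i < s) (b M i).[alpha] * c M i ^+ 3 = alpha ^+ 5 / 20
     & forall (alpha beta : R) (m : nat), (m < size cstar)%N ->
         0 <= alpha <= 1 -> 0 <= beta <= cstar`_m ->
         \sum_(i < s | c M i == cstar`_m) (b M i).[alpha] *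
           (\sum_(j < s) (A M i j).[beta] * c M j - beta ^+ 3 / 6) = 0]).
Proof.
move=> S ord4.
have S_test k (a : R -> R) lam (ac : continuous a) (a1 : forall t, `|a t| <= 1)
    (lam01 : 0 <= lam <= 1) : S (test_problem k ac a1 lam01).
  by split; [exact: test_class_C2|exact: test_solution_smooth].
have f11 : 1`!%:R / (1 + 2)`!%:R = 6^-1 :> R by rewrite div1r.
have f22 : 2`!%:R / (2 + 2)`!%:R = 12^-1 :> R.
  by rewrite (_ : 2`! = 2)%N// (_ : (2 + 2)`! = 24)%N//; field.
have f41 : 4`!%:R / (4 + 1)`!%:R = 5^-1 :> R.
  by rewrite (_ : 4`! = 24)%N// (_ : (4 + 1)`! = 120)%N//; field.
have f32 : 3`!%:R / (3 + 2)`!%:R = 20^-1 :> R.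
  by rewrite (_ : 3`! = 6)%N// (_ : (3 + 2)`! = 120)%N//; field.
have def1 i beta : (stage_defect M 1 i).[beta]
    = \sum_(j < s) (A M i j).[beta] * c M j - beta ^+ 3 / 6.
  by rewrite horner_stage_defect f11 mulrC.
have def2 i beta : (stage_defect M 2 i).[beta]
    = \sum_(j < s) (A M i j).[beta] * c M j ^+ 2 - beta ^+ 4 / 12.
  by rewrite horner_stage_defect f22 mulrC.
have l1 : (0 < 1 <= 2)%N by [].
have l2 : (0 < 2 <= 2)%N by [].
split=> [ord5|[q1 s1 q2 s2]].
  have Q1 := quadrature_necessary ord5 S_test l1.
  have Q2 := quadrature_necessary ord5 S_test l2.
  have S1 := stage_necessary ord5 S_test l1.
  have S2 := stage_necessary ord5 S_test l2.
  split.
  - by move=> alpha a01; rewrite (Q1 4%N alpha isT a01) f41 mulrC.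
  - move=> alpha beta m _ a01 bm; rewrite -[RHS](S1 _ _ _ 2%N isT a01 bm).
    by apply: eq_bigr => i _; rewrite def2.
  - by move=> alpha a01; rewrite (Q2 3%N alpha isT a01) f32 mulrC.
  - move=> alpha beta m _ a01 bm; rewrite -[RHS](S2 _ _ _ 1%N isT a01 bm).
    by apply: eq_bigr => i _; rewrite def1.
have Q1 := quadrature_necessary ord4 S_test l1.
have Q2 := quadrature_necessary ord4 S_test l2.
have S1 := stage_necessary ord4 S_test l1.
have S2 := stage_necessary ord4 S_test l2.
(* Class C^7, one derivative more than in the class of problems, turns the
   remainder [o(h ^+ 5)] of the last expansion into [O(h ^+ 6)]. *)
exists 7%N => P [PC2 _]; apply: order_five_of_conditions PC2 => //.
- move=> k alpha; rewrite ltnS leq_eqVlt => /predU1P[->|k4] a01; last exact: Q1.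
  by rewrite q1// f41 mulrC.
- move=> x alpha beta k; rewrite ltnS leq_eqVlt => /predU1P[->|k2] a01 bx;
    last exact: S1.
  under eq_bigr do rewrite def2.
  have [xc|xc] := boolP (x \in cstar).
    move: bx; rewrite -(nth_index 0 xc) => bx.
    by apply: s1; rewrite ?index_mem.
  rewrite big_pred0// => i; apply: contraNF xc => /eqP ci.
  by rewrite cstar_values; apply/existsP; exists i; rewrite ci.
- move=> k alpha; rewrite ltnS leq_eqVlt => /predU1P[->|k3] a01; last exact: Q2.
  by rewrite q2// f32 mulrC.
- move=> x alpha beta k; rewrite ltnS leq_eqVlt => /predU1P[->|k2] a01 bx;
    last exact: S2.
  under eq_bigr do rewrite def1.
  have [xc|xc] := boolP (x \in cstar).
    move: bx; rewrite -(nth_index 0 xc) => bx.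
    by apply: s2; rewrite ?index_mem.
  rewrite big_pred0// => i; apply: contraNF xc => /eqP ci.
  by rewrite cstar_values; apply/existsP; exists i; rewrite ci.
Qed.
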